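(* For every $p\in(1,\infty)$ there exist constants $c(p)>0$ and $C(p)<\infty$, depending only on $p$, such that for every $M>2$ there exists a weight $w$ on $\mathbb{R}$ with $M\le [w]_{A_p}^{\mathrm{fat}}\le C(p)M$ and $$\|H\|_{L^p(w)}\ge c(p)\,M^{s},\qquad s=\max\{1,\,1/(p-1)\}.$$
   Context: A weight on $\mathbb{R}$ is a locally integrable function that is positive a.e. The norm in $L^p(w)$ is $\|f\|_{L^p(w)}^p=\int_{\mathbb{R}}|f(x)|^pw(x)\,dx$. For $1<p<\infty$, with $p'$ the Hölder conjugate of $p$ ($1/p+1/p'=1$) and $\mathbb{C}_+$ the open upper half-plane, the ''fattened'' $A_p$ characteristic is $$[w]_{A_p}^{\mathrm{fat}}=\sup_{\lambda\in\mathbb{C}_+}\Big(\int_{\mathbb{R}}\frac{(\operatorname{Im}\lambda)^{p-1}}{|x-\lambda|^{p}}w(x)\,dx\Big)\Big(\int_{\mathbb{R}}\frac{(\operatorname{Im}\lambda)^{p'-1}}{|x-\lambda|^{p'}}w(x)^{-1/(p-1)}\,dx\Big)^{p-1}.$$ $H$ is the Hilbert transform, $Hf(x)=\mathrm{p.v.}\int_{\mathbb{R}}\frac{f(y)}{x-y}\,dy$, and $\|H\|_{L^p(w)}$ denotes its operator norm on $L^p(w)$. *)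

(* Defs.v *)
From HB Require Import structures.
From mathcomp Require Import all_boot all_order all_algebra.
From mathcomp Require Import complex.
From mathcomp Require Import all_classical all_reals all_analysis.

Set Implicit Arguments.
Unset Strict Implicit.
Unset Printing Implicit Defensive.

Import Order.TTheory GRing.Theory Num.Theory.
Import numFieldNormedType.Exports.

Local Open Scope classical_set_scope.
Local Open Scope ring_scope.

Section weights.
Context {R : realType}.
Local Notation mu := (@lebesgue_measure R).

Definition weight (w : R -> R) : Prop :=
  locally_integrable [set: R] w /\ {ae mu, forall x, 0 < w x}.

Definition Lpw_norm (p : R) (w f : R -> R) : \bar R :=
  ((\int[mu]_x (`|f x| `^ p * w x)%:E) `^ p^-1)%E.

Definition fat_kernel (r : R) (l : R[i]) (x : R) : R :=
  complex.Im l `^ (r - 1) / ComplexField.Normc.normc (x%:C%C - l) `^ r.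

Definition fat_Ap (p : R) (w : R -> R) : \bar R :=
  let p' := p / (p - 1) in
  ereal_sup [set ((\int[mu]_x (fat_kernel p l x * w x)%:E) *
                  (\int[mu]_x (fat_kernel p' l x * w x `^ (- (p - 1)^-1))%:E)
                    `^ (p - 1))%E
            | l in [set l : R[i] | 0 < complex.Im l]].

Definition hilbert_trunc (f : R -> R) (x e : R) : R :=
  \int[mu]_(y in [set y | e < `|x - y|]) (f y / (x - y)).

Definition has_hilbert (f : R -> R) (x : R) : Prop :=
  (forall e : R, 0 < e ->
     mu.-integrable [set y | e < `|x - y|] (fun y => (f y / (x - y))%:E)) /\
  cvg (hilbert_trunc f x e @[e --> 0^'+]).

Definition hilbert (f : R -> R) (x : R) : R :=
  lim (hilbert_trunc f x e @[e --> 0^'+]).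

(* The operator norm is a supremum over the unit ball of L^p(w).  Functions f
   whose principal value fails to exist on a non-null set are left out, so that
   the arbitrary values of [hilbert] never contribute; when [fat_Ap p w] is
   finite, the principal value exists a.e. for every f in L^p(w). *)
Definition hilbert_norm (p : R) (w : R -> R) : \bar R :=
  ereal_sup [set Lpw_norm p w (hilbert f)
            | f in [set f : R -> R | [/\ measurable_fun [set: R] f,
                                         (Lpw_norm p w f <= 1)%E &
                                         {ae mu, forall x, has_hilbert f x}]]].

End weights.

(* Main.v *)
Require Import Defs.
From mathcomp Require Import all_boot all_order all_algebra.
From mathcomp Require Import all_classical all_reals all_analysis.
From mathcomp Require Import measurable_realfun complex.
From mathcomp Require Import ring lra zify.

(** Power weights do not work: their fattened characteristic is too large, because
    the tails of the kernels see all scales. The extremal weights are built on the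
    1-periodic Cantor set [E_k] of all reals whose fractional parts at the scales
    [1, 256^-1, ..., 256^(1-k)] lie in [[8/16, 9/16)]:
      [w_N = sum_(k < N) 16^k 1_(E_k) + N 16^N 1_(E_N)].
    Near a point of [E_j], at the scale [256^-j], the averages of [w_N] are of order
    [N 16^j], whereas [w_N] itself is at least [16^j] there and decays only like the
    inverse square root of the distance; hence the fattened characteristic of [w_N]
    is comparable to [N], and that of the dual weight [w_N^(1-p)] to [N^(p-1)].

    At each scale [k < n], [N = n + 1], put charge [+1] on the band just left of the
    middle one and [-1] on the band just right of it. The resulting function [f] is
    bounded by [1] and vanishes on [E_n], so that [|f|_(L^p(w_N))^p <= 2N]; but on
    [E_N] the contributions of the [n] scales to [Hf] have the same sign and are
    bounded below, so [Hf >= c n] on a set of [w_N]-mass [N]. This gives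
    [|H| >= c N] on [L^p(w_N)], and by duality on [L^p(w_N^(1-p))], where one tests
    [H] on the indicator of [E_N] in the unit interval. The first family is extremal
    for [p >= 2], the second for [p <= 2]. *)

Set Implicit Arguments.
Unset Strict Implicit.
Unset Printing Implicit Defensive.

Import Order.TTheory GRing.Theory Num.Theory.
Import numFieldNormedType.Exports.

Local Open Scope classical_set_scope.
Local Open Scope ring_scope.

(** * Integrals on the line *)

Section affine_change_of_variables.
Context {R : realType}.
Local Notation mu := (@lebesgue_measure R).
Implicit Types (a b : R).

Lemma measurable_affine a b :
  measurable_fun [set: R] (fun x : R => a * x + b).
Proof. by apply: measurable_funD => //; apply: measurable_funM. Qed.

Lemma pushforward_affine a b : exists m : {measure set (measurableTypeR R) -> \bar R},
  forall A, m A = mu ((fun x => a * x + b) @^-1` A).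
Proof.
unshelve eexists (pushforward mu (fun x => a * x + b : measurableTypeR R)) => //.
exact: measurable_affine.
Qed.

(** Uniqueness of Lebesgue measure: |a| times the push-forward gives every interval []c, d]] its
    length. For a < 0 the preimage is closed at the other end, which does not change its length. *)
Lemma lebesgue_measure_affine a b (A : set R) : a != 0 -> measurable A ->
  mu ((fun x => a * x + b) @^-1` A) = (`|a|^-1%:E * mu A)%E.
Proof.
move=> a0 mA.
have [m mE] := pushforward_affine a b.
pose nu : {measure set (measurableTypeR R) -> \bar R} := mscale (NngNum (normr_ge0 a)) m.
have nuE B : nu B = (`|a|%:E * m B)%E by [].
have : mu A = nu A.
  apply: (@lebesgue_measure_unique R nu) => // _ [[c d] _ <-].
  rewrite nuE mE.
  have [a_gt0|a_lt0|a00] := ltgtP 0 a; last by rewrite a00 eqxx in a0.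
    rewrite (_ : _ @^-1` _ = `](c - b) / a, (d - b) / a]%classic).
      rewrite !lebesgue_measure_itv /= !lte_fin ltr_pM2r ?invr_gt0// ltrBlDr subrK.
      case: ifP => _; last by rewrite mule0.
      rewrite -!EFinB -EFinM gtr0_norm//; congr EFin; field; exact: lt0r_neq0.
    apply/seteqP; split => x /=; rewrite !in_itv /= ltr_pdivrMr// ler_pdivlMr//;
    rewrite ltrBlDr lerBrDr (mulrC x)//.
  rewrite (_ : _ @^-1` _ = `[(d - b) / a, (c - b) / a[%classic).
    rewrite !lebesgue_measure_itv /= !lte_fin ltr_nM2r ?invr_lt0// ltrBlDr subrK.
    case: ifP => _; last by rewrite mule0.
    rewrite -!EFinB -EFinM ltr0_norm//; congr EFin; field; exact: ltr0_neq0.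
  apply/seteqP; split => x /=; rewrite !in_itv /= ler_ndivrMr// ltr_ndivlMr//;
  by rewrite ltrBlDr lerBrDr (mulrC x)// andbC.
move=> ->; rewrite nuE mE muleA -EFinM mulVf ?normr_eq0// mul1e.
by [].
Qed.

Lemma ge0_integral_affine a b (f : R -> \bar R) : a != 0 ->
  measurable_fun [set: R] f -> (forall x, 0 <= f x)%E ->
  (\int[mu]_x f (a * x + b)%R = `|a|^-1%:E * \int[mu]_x f x)%E.
Proof.
move=> a0 mf f0.
have -> : (\int[mu]_x f (a * x + b)%R =
    \int[pushforward mu (fun x => (a * x + b)%R : measurableTypeR R)]_x f x)%E.
  by rewrite ge0_integral_pushforward//; exact: measurable_affine.
have ia0 : 0 <= `|a|^-1 by rewrite invr_ge0.
rewrite -(@ge0_integral_mscale _ _ _ mu _ measurableT (NngNum ia0) f)//.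
have [m mE] := pushforward_affine a b.
have <- : (m : set R -> \bar R) = pushforward mu (fun x => a * x + b : measurableTypeR R).
  by apply/funext => B; rewrite mE.
suff : (\int[m]_x f x = \int[mscale (NngNum ia0) mu]_x f x)%E.
  by move=> ->.
apply: eq_measure_integral => A mA _.
by rewrite mE lebesgue_measure_affine.
Qed.

Lemma integrable_affine a b (f : R -> \bar R) : a != 0 ->
  mu.-integrable [set: R] f -> mu.-integrable [set: R] (fun x => f (a * x + b)).
Proof.
move=> a0 /integrableP[mf foo]; apply/integrableP; split.
  by apply: (measurableT_comp mf); exact: measurable_affine.
rewrite (@ge0_integral_affine a b (fun x => `|f x|)%E)//; last exact: measurableT_comp.
by rewrite lte_mul_pinfty.
Qed.

Lemma integral_affine a b (f : R -> \bar R) : a != 0 ->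
  mu.-integrable [set: R] f ->
  (\int[mu]_x f (a * x + b)%R = `|a|^-1%:E * \int[mu]_x f x)%E.
Proof.
move=> a0 intf; have mf := measurable_int _ intf.
rewrite integralE [in RHS]integralE muleBr//; last first.
  by apply: fin_num_adde_defr; exact: integrable_pos_fin_num.
have h1 : (\int[mu]_x f^\+ (a * x + b)%R = `|a|^-1%:E * \int[mu]_x f^\+ x)%E.
  by apply: ge0_integral_affine => //; exact: measurable_funepos.
have h2 : (\int[mu]_x f^\- (a * x + b)%R = `|a|^-1%:E * \int[mu]_x f^\- x)%E.
  by apply: ge0_integral_affine => //; exact: measurable_funeneg.
rewrite -h1 -h2; congr (_ - _)%E; apply: eq_integral => x _.
  by rewrite !funepos.unlock.
by rewrite !funeneg.unlock.
Qed.

End affine_change_of_variables.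

(** * Integral of the kernel profile *)

Section tail_integral.
Context {R : realType}.
Local Notation mu := (@lebesgue_measure R).

Lemma is_derive_powR_add1 (a x : R) : 0 < 1 + x ->
  is_derive x 1 (fun y => (1 + y) `^ a) (a * (1 + x) `^ (a - 1)).
Proof.
move=> x0.
have d := is_derive1_powR a x0.
have d2 : is_derive x 1 (cst (1 : R) + id) (0 + 1 : R) by exact: is_deriveD.
have := @is_derive1_comp R (@powR R ^~ a) _ x _ _ d d2.
by rewrite add0r mulr1.
Qed.

Lemma cvg_powR_add1_neg (a : R) : a < 0 ->
  (1 + x) `^ a @[x --> +oo] --> (0 : R).
Proof.
move=> a0; apply/cvgr0Pnorm_lt => e e0.
near=> x.
have x0 : 0 < 1 + x.
  have : 0 < x by near: x; apply: nbhs_pinfty_gt; exact: num_real.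
  lra.
rewrite ger0_norm ?powR_ge0//.
rewrite -[a]opprK powRN invf_plt ?posrE ?powR_gt0//.
have na : 0 < - a by rewrite oppr_gt0.
have -> : e^-1 = (e^-1 `^ (- a)^-1) `^ (- a).
  by rewrite -powRrM mulVf ?gt_eqF// powRr1// invr_ge0 ltW.
rewrite gt0_ltr_powR// ?nnegrE ?powR_ge0 ?(ltW x0)//.
have : e^-1 `^ (- a)^-1 < x by near: x; apply: nbhs_pinfty_gt; exact: num_real.
lra.
Unshelve. all: by end_near. Qed.

Lemma integral_powR_half (q : R) : 1 < q ->
  (\int[mu]_(x in `[0%R, +oo[) ((1 + x) `^ (- q))%:E = ((q - 1)^-1)%:E)%E.
Proof.
move=> q1.
pose F (x : R) := - (q - 1)^-1 * (1 + x) `^ (1 - q).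
have q10 : 0 < q - 1 by rewrite subr_gt0.
have dF (x : R) : 0 < 1 + x -> is_derive x 1 F ((1 + x) `^ (- q)).
  move=> x0; have d := is_derive_powR_add1 (1 - q) x0.
  apply: is_derive_eq.
  rewrite /GRing.scale /= (_ : 1 - q - 1 = - q); last by ring.
  by field; exact: lt0r_neq0.
rewrite (@ge0_continuous_FTC2y _ _ F 0 0).
- rewrite /F addr0 powR1 mulr1 sub0e -EFinN opprK//.
- by move=> x _; exact: powR_ge0.
- apply: derivable_within_continuous => x; rewrite in_itv/= andbT => x0.
  have x10 : 0 < 1 + x by lra.
  by have [] := is_derive_powR_add1 (- q) x10.
- rewrite -(mulr0 (- (q - 1)^-1)); apply: cvgMr; apply: cvg_powR_add1_neg.
  by rewrite subr_lt0.
- move=> x x0; have x10 : 0 < 1 + x by lra.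
  by have [] := dF x x10.
- apply: cvg_at_right_filter; apply: differentiable_continuous.
  have x10 : 0 < 1 + 0 :> R by lra.
  by apply/derivable1_diffP; have [] := dF 0 x10.
- move=> x; rewrite in_itv/= andbT => x0; rewrite derive1E.
  have x10 : 0 < 1 + x by lra.
  by have [_ ->] := dF x x10.
Qed.

Lemma integral_powR_tail (q : R) : 1 < q ->
  (\int[mu]_x ((1 + `|x|) `^ (- q))%:E = (2 / (q - 1))%:E)%E.
Proof.
move=> q1.
pose f (x : R) : \bar R := ((1 + `|x|) `^ (- q))%:E.
have f0 x : (0 <= f x)%E by rewrite lee_fin powR_ge0.
have mf : measurable_fun [set: R] f.
  apply/measurable_EFinP.
  apply: (measurableT_comp (measurable_powR _)).
  by apply: measurable_funD => //; exact: normr_measurable.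
have fN : (\int[mu]_(x in `[0%R, +oo[) f x = \int[mu]_(x in `]-oo, 0%R]) f x)%E.
  rewrite ge0_integration_by_substitution0//.
  by apply: eq_integral => x _; rewrite /f normrN.
have f1 : (\int[mu]_(x in `[0%R, +oo[) f x = ((q - 1)^-1)%:E)%E.
  rewrite -integral_powR_half//; apply: eq_integral => x; rewrite inE/= in_itv/= andbT => x0.
  by rewrite /f ger0_norm.
have -> : [set: R] = `]-oo, 0[%classic `|` `[0, +oo[%classic.
  by apply/seteqP; split => x //= _; rewrite !in_itv/= andbT; apply/orP; case: ltP.
rewrite ge0_integral_setU//; last 2 first.
- exact: measurable_funTS.
- apply/disj_setPS => x /=; rewrite !in_itv/= andbT => -[]; lra.
rewrite integral_itv_bndo_bndc; last exact: measurable_funTS.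
rewrite -fN f1 -EFinD; congr EFin.
by field; rewrite subr_eq0 gt_eqF.
Qed.

End tail_integral.

(** * Poisson-type kernels *)

Section kernel.
Context {R : realType}.
Local Notation mu := (@lebesgue_measure R).
Implicit Types (q s u v h y : R).

Lemma ge0_ler_powRN q x y : 0 <= q -> 0 < x -> x <= y ->
  y `^ (- q) <= x `^ (- q).
Proof.
move=> q0 x0 xy; have y0 := lt_le_trans x0 xy.
rewrite !powRN lef_pV2 ?posrE ?powR_gt0//.
by rewrite ge0_ler_powR// nnegrE ltW.
Qed.

(* A normalized Poisson-type kernel at height [v] over [u], flattened on the
   ball of radius [s] so that translations by at most [s] cost nothing. *)
Definition pkernel q s u v y : R :=
  v^-1 * (1 + Num.max 0 (`|y - u| - s) / v) `^ (- q).

Lemma pkernel_ge0 q s u v y : 0 < v -> 0 <= pkernel q s u v y.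
Proof. by move=> v0; rewrite mulr_ge0 ?powR_ge0// invr_ge0 ltW. Qed.

Lemma pkernel0E q u v y :
  pkernel q 0 u v y = v^-1 * (1 + `|y - u| / v) `^ (- q).
Proof. by rewrite /pkernel subr0; congr (_ * (_ + _ / _) `^ _); apply/max_idPr. Qed.

Lemma measurable_pkernel q s u v : measurable_fun [set: R] (pkernel q s u v).
Proof.
apply: measurable_funM => //; apply: (measurableT_comp (measurable_powR _)).
apply: measurable_funD => //; apply: measurable_funM => //.
apply: measurable_maxr => //; apply: measurable_funB => //.
by apply: measurableT_comp => //; apply: measurable_funB.
Qed.

Lemma le_pkernel_shift q s u v y a : 0 <= q -> 0 < v ->
  pkernel q s u v y <= pkernel q (s + `|a|) u v (y + a).
Proof.
move=> q0 v0; rewrite ler_pM2l ?invr_gt0//; apply: ge0_ler_powRN => //.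
  by rewrite ltr_wpDr// divr_ge0 ?(ltW v0)// le_max lexx.
rewrite lerD2l ler_pM2r ?invr_gt0// ge_max le_max lexx /=.
rewrite le_max; apply/orP; right.
have := ler_normD (y - u) a; rewrite (_ : y - u + a = y + a - u); last by ring.
lra.
Qed.

(** When s <= v, flattening shortens [|y - u| / v] by at most 1, and the summand 1 absorbs this up
    to a factor 2. *)
Lemma pkernel_slack q s u v y : 0 <= q -> 0 < v -> s <= v ->
  pkernel q s u v y <= 2 `^ q * pkernel q 0 u v y.
Proof.
move=> q0 v0 sv; rewrite pkernel0E /pkernel mulrCA ler_pM2l ?invr_gt0//.
have m0 : 0 <= Num.max 0 (`|y - u| - s) by rewrite le_max lexx.
have m1 : `|y - u| - s <= Num.max 0 (`|y - u| - s) by rewrite le_max lexx orbT.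
have x0 : 0 <= 1 + `|y - u| / v by rewrite addr_ge0// divr_ge0// ltW.
have -> : 2 `^ q = 2^-1 `^ (- q) by rewrite -powR_inv1// -powRrM mulrNN mul1r.
rewrite -powRM//; apply: ge0_ler_powRN => //.
  by rewrite mulr_gt0 ?invr_gt0// ltr_wpDr// divr_ge0// ltW.
rewrite -(ler_pM2l (_ : 0 < 2 * v)); last by rewrite mulr_gt0.
rewrite (_ : 2 * v * _ = v + `|y - u|); last by field; exact: lt0r_neq0.
rewrite (_ : 2 * v * _ = 2 * v + 2 * Num.max 0 (`|y - u| - s)); last first.
  by field; exact: lt0r_neq0.
lra.
Qed.

Lemma kernel_powR_split q v d : 0 < v -> 0 <= d ->
  v^-1 * (1 + d / v) `^ (- q) = v `^ (q - 1) * (v + d) `^ (- q).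
Proof.
move=> v0 d0.
have -> : v + d = v * (1 + d / v) by field; exact: lt0r_neq0.
have w0 : 0 <= 1 + d / v by rewrite addr_ge0// divr_ge0// ltW.
rewrite powRM ?(ltW v0)// mulrA -powRD; last by rewrite lt0r_neq0// implybT.
by rewrite (_ : q - 1 + - q = -1) ?powR_inv1 ?(ltW v0)//; ring.
Qed.

(** The kernel is v^(q-1) (v + d)^-q with d = |y - u|. Raising v to h increases the first factor,
    and h <= d keeps v + d above half of h + d. *)
Lemma pkernel_raise q u v h y : 1 <= q -> 0 < v -> v <= h -> h <= `|y - u| ->
  pkernel q 0 u v y <= 2 `^ q * pkernel q 0 u h y.
Proof.
move=> q1 v0 vh hd; rewrite !pkernel0E.
have h0 : 0 < h by exact: lt_le_trans vh.
have d0 : 0 < `|y - u| by exact: lt_le_trans hd.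
rewrite !kernel_powR_split// mulrCA ler_pM ?powR_ge0//.
  by rewrite ge0_ler_powR ?nnegrE ?(ltW v0) ?(ltW h0)// subr_ge0.
have -> : 2 `^ q = 2^-1 `^ (- q) by rewrite -powR_inv1// -powRrM mulrNN mul1r.
rewrite -powRM//; last by rewrite addr_ge0// ltW.
apply: ge0_ler_powRN; [lra| |].
  by rewrite mulr_gt0 ?invr_gt0// addr_gt0.
lra.
Qed.

Lemma integral_pkernel q u v : 1 < q -> 0 < v ->
  (\int[mu]_y (pkernel q 0 u v y)%:E = (2 / (q - 1))%:E)%E.
Proof.
move=> q1 v0.
pose f (x : R) : \bar R := ((1 + `|x|) `^ (- q))%:E.
have mf : measurable_fun [set: R] f.
  apply/measurable_EFinP.
  apply: (measurableT_comp (measurable_powR _)).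
  by apply: measurable_funD => //; exact: normr_measurable.
have f0 x : (0 <= f x)%E by rewrite lee_fin powR_ge0.
have vi : v^-1 != 0 by rewrite invr_eq0 lt0r_neq0.
transitivity (\int[mu]_y (v^-1%:E * f (v^-1 * y + - (u / v))%R))%E.
  apply: eq_integral => y _; rewrite pkernel0E /f -EFinM; congr (_ * (_ + _) `^ _)%:E.
  rewrite -(_ : `|(y - u) / v| = `|y - u| / v).
    by congr (`|_|); field; exact: lt0r_neq0.
  by rewrite normrM normfV [`|v|]gtr0_norm.
rewrite ge0_integralZl//; last 2 first.
- by apply: (measurableT_comp mf); exact: measurable_affine.
- by rewrite lee_fin invr_ge0 ltW.
rewrite ge0_integral_affine// integral_powR_tail// muleA -EFinM.
by rewrite normfV invrK gtr0_norm// mulVf ?mul1r ?lt0r_neq0.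
Qed.

End kernel.

(** * The Cantor set *)

Section cantor_set.
Context {R : realType}.
Local Notation mu := (@lebesgue_measure R).
Implicit Types (x y z : R) (i k l b : nat).

Definition pow256 k : R := 256 ^+ k.

Lemma pow256_gt0 k : 0 < pow256 k.
Proof. by rewrite exprn_gt0// ltr0n. Qed.
Hint Resolve pow256_gt0 : core.

Lemma pow256_neq0 k : pow256 k != 0.
Proof. exact: lt0r_neq0. Qed.

Lemma pow256_0 : pow256 0 = 1. Proof. by rewrite /pow256 expr0. Qed.

Lemma pow256S k : pow256 k.+1 = 256 * pow256 k.
Proof. by rewrite /pow256 exprS. Qed.

Lemma pow256D i k : pow256 (i + k) = pow256 i * pow256 k.
Proof. by rewrite /pow256 exprD. Qed.

Lemma pow256E k : pow256 k = (256 ^ k)%N%:~R.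
Proof. by rewrite /pow256 -pmulrn natrX. Qed.

(* The reals whose fractional part has [b] as first hexadecimal digit. *)
Definition band b : set R :=
  \bigcup_(m : int) `[m%:~R + b%:R / 16, m%:~R + (b%:R + 1) / 16[%classic.

Lemma bandP b x : band b x <->
  exists m : int, m%:~R + b%:R / 16 <= x < m%:~R + (b%:R + 1) / 16.
Proof.
split=> [[m _ /=]|[m xm]]; first by rewrite in_itv/= => xm; exists m.
by exists m => //=; rewrite in_itv.
Qed.

Lemma measurable_band b : measurable (band b).
Proof. by apply: countable_bigcupT_measurable => // m; exact: measurable_itv. Qed.

Lemma band_shift b x n : band b (x + n%:R) <-> band b x.
Proof.
have e m : (m + n%:Z)%:~R = m%:~R + n%:R :> R by rewrite intrD -pmulrn.
have e' m : (m - n%:Z)%:~R = m%:~R - n%:R :> R by rewrite intrB -pmulrn.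
split=> /bandP [m xm]; apply/bandP.
  by exists (m - n%:Z); rewrite e'; move: xm; lra.
by exists (m + n%:Z); rewrite e; move: xm; lra.
Qed.

(* The stage [k] of a 1-periodic Cantor set keeping, at each of the scales
   [1, 256^-1, 256^-2, ...], the sixteenth part in the middle of each cell. *)
Definition cset k : set R :=
  [set x | forall i, (i < k)%N -> band 8 (pow256 i * x)].

Lemma cset0 : cset 0 = setT.
Proof. by apply/seteqP; split. Qed.

Lemma csetS k x : cset k.+1 x <-> cset k x /\ band 8 (pow256 k * x).
Proof.
split=> [xk|[xk xb] i]; last by rewrite ltnS leq_eqVlt => /predU1P[->//|/xk].
by split=> [i ik|]; apply: xk => //; exact: ltnW.
Qed.

Lemma csetSl k x : cset k.+1 x <-> band 8 x /\ cset k (256 * x).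
Proof.
split=> [xk|[xb xk] [|i]].
- split=> [|i ik]; first by have := xk 0%N isT; rewrite pow256_0 mul1r.
  by have := xk i.+1 ik; rewrite pow256S mulrA [256 * _]mulrC.
- by rewrite pow256_0 mul1r.
- by rewrite ltnS => /xk; rewrite pow256S mulrA [256 * _]mulrC.
Qed.

Lemma cset_sub i k : (i <= k)%N -> cset k `<=` cset i.
Proof. by move=> ik x xk j ji; apply: xk; exact: leq_trans ik. Qed.

Lemma cset_shift k x n : cset k (x + n%:R) <-> cset k x.
Proof.
have e i : pow256 i * (x + n%:R) = pow256 i * x + (256 ^ i * n)%N%:R.
  by rewrite mulrDr natrM natrX.
split=> xk i /xk; rewrite e; first by move/band_shift.
by move=> ?; exact/band_shift.
Qed.

Lemma measurable_scale_preimage (c : R) (A : set R) : measurable A ->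
  measurable [set x | A (c * x)].
Proof.
by move=> mA; rewrite -[X in measurable X]setTI; exact: (@mulrl_measurable R setT c measurableT _ mA).
Qed.

Lemma measurable_cset k : measurable (cset k).
Proof.
elim: k => [|k IH]; first by rewrite cset0.
rewrite (_ : cset k.+1 = cset k `&` [set x | band 8 (pow256 k * x)]).
  by apply: measurableI => //; apply: measurable_scale_preimage; exact: measurable_band.
by apply/seteqP; split=> x /csetS.
Qed.

Lemma le_pow256_floor k x y (m : int) :
  Num.floor (pow256 k * x) = Num.floor (pow256 k * y) ->
  (m%:~R <= pow256 k * x) = (m%:~R <= pow256 k * y).
Proof. by move=> xy; rewrite -!floor_ge_int xy. Qed.

(** In units of 256^-k the ends of a band at a coarser scale i are integers, because 16 divides 256;
    comparing a point with an integer depends only on its floor. *)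
Lemma band_floor i k b x y : (i < k)%N ->
  Num.floor (pow256 k * x) = Num.floor (pow256 k * y) ->
  band b (pow256 i * x) -> band b (pow256 i * y).
Proof.
move=> ik xy /bandP[m xm]; apply/bandP; exists m; move: xm.
have pk : pow256 k = 256 * pow256 (k - i.+1) * pow256 i.
  by rewrite -pow256S -pow256D -subSn// subSS subnK// ltnW.
have le (c : nat) z : (m%:~R + c%:R / 16 <= pow256 i * z) =
    (((256 * m + 16 * c%:Z) * (256 ^ (k - i.+1))%N)%:~R <= pow256 k * z).
  rewrite pk intrM -pow256E intrD !intrM -!pmulrn -mulrA.
  rewrite -(@ler_pM2l _ (256 * pow256 (k - i.+1))) ?mulr_gt0 ?ltr0n//.
  by congr (_ <= _); field.
have e : b%:R + 1 = b.+1%:R :> R by rewrite natr1.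
by rewrite e !ltNge !le !(le_pow256_floor _ xy).
Qed.

Lemma cset_floor k x y :
  Num.floor (pow256 k * x) = Num.floor (pow256 k * y) -> cset k x -> cset k y.
Proof. by move=> xy xk i ik; apply: (band_floor ik xy); exact: xk. Qed.

(** The middle band [8/16, 9/16) keeps a distance of more than 1/4 from the integers, so a move by
    less than 1/4 crosses none. *)
Lemma floor_middle k y z : band 8 (pow256 k * z) ->
  pow256 k * `|y - z| < 1 / 4 ->
  Num.floor (pow256 k * y) = Num.floor (pow256 k * z).
Proof.
move=> /bandP[m zm] yz.
have /andP[y1 y2] : (- (1 / 4) < pow256 k * y - pow256 k * z < 1 / 4).
  by rewrite -mulrBr -ltr_norml normrM gtr0_norm.
transitivity m; last symmetry; apply/eqP; rewrite floor_eq intrD; lra.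
Qed.

(** Each stage lies well inside the previous one: leaving stage k from a point of stage k + 1 takes
    a distance comparable to 256^-k. The decay of the weight and the separation from the charges
    both rest on this. *)
Lemma cset_near k y z : cset k.+1 z -> pow256 k * `|y - z| < 1 / 4 -> cset k y.
Proof.
move=> /csetS[zk zb] /(floor_middle zb) /esym yz; exact: cset_floor yz zk.
Qed.

End cantor_set.
#[global] Hint Resolve pow256_gt0 : core.

Section nonmeasurable_monotonicity.
Context d (T : measurableType d) (R : realType) (mu : {measure set T -> \bar R}).

(* The integral of a nonnegative function is a supremum over the simple functions
   below it, so no measurability is needed here. *)
Lemma ge0_le_integral_any (f g : T -> \bar R) :
  (forall x, 0 <= f x)%E -> (forall x, f x <= g x)%E ->
  (\int[mu]_x f x <= \int[mu]_x g x)%E.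
Proof.
move=> f0 fg; have g0 x : (0 <= g x)%E by exact: le_trans (fg x).
rewrite !ge0_integralTE//; apply: ereal_sup_le => _ [h hf <-].
by exists h => // x; exact: le_trans (hf x) (fg x).
Qed.

Lemma ge0_le_integral_anyr (f g : T -> R) :
  (forall x, 0 <= f x) -> (forall x, f x <= g x) ->
  (\int[mu]_x (f x)%:E <= \int[mu]_x (g x)%:E)%E.
Proof. by move=> f0 fg; apply: ge0_le_integral_any => x; rewrite lee_fin. Qed.

End nonmeasurable_monotonicity.

(** * Density and translates of the Cantor set *)

Section cantor_averages.
Context {R : realType}.
Local Notation mu := (@lebesgue_measure R).
Implicit Types (x y z : R) (i k l b : nat) (A : set R).

Lemma measurable_indic_affine A (a b : R) : measurable A ->
  measurable_fun [set: R] (fun x : R => \1_A (a * x + b) : R).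
Proof.
move=> mA; apply: (@measurableT_comp _ _ _ _ _ _ (\1_A : R -> R)).
  exact: measurable_indic.
exact: measurable_affine.
Qed.

Lemma lebesgue_measure_periodic_cell A n : measurable A ->
  (forall x n, A (x + n%:R) <-> A x) ->
  mu (A `&` `[n%:R, n%:R + 1[) = mu (A `&` `[0, 1[).
Proof.
move=> mA per.
have := @lebesgue_measure_affine R 1 n%:R (A `&` `[n%:R, n%:R + 1[) (oner_neq0 _).
rewrite normr1 invr1 mul1e => <-; last exact: measurableI.
congr (mu _); apply/seteqP; split => x /=; rewrite !in_itv/= mul1r per => -[Ax xn];
  by split=> //; lra.
Qed.

Lemma lebesgue_measure_periodic A m n : measurable A ->
  (forall x n, A (x + n%:R) <-> A x) ->
  mu (A `&` `[m%:R, m%:R + n%:R[) = (n%:R%:E * mu (A `&` `[0%R, 1%R[))%E.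
Proof.
move=> mA per; elim: n => [|n IH].
  by rewrite addr0 set_itvco0 setI0 measure0 mul0e.
have -> : A `&` `[m%:R, m%:R + n.+1%:R[ =
    (A `&` `[m%:R, m%:R + n%:R[) `|` (A `&` `[(m + n)%:R, (m + n)%:R + 1[).
  rewrite -setIUr; congr (_ `&` _); rewrite natrD -[n.+1%:R]natr1.
  have n0 := ler0n R n; apply/seteqP; split => x /=; rewrite !in_itv/=.
    by case: (ltP x (m%:R + n%:R)) => xmn x1; [left|right]; lra.
  by case=> x1; lra.
have mUn : mu ((A `&` `[m%:R, m%:R + n%:R[) `|` (A `&` `[(m + n)%:R, (m + n)%:R + 1[)) =
    adde (mu (A `&` `[m%:R, m%:R + n%:R[)) (mu (A `&` `[(m + n)%:R, (m + n)%:R + 1[)).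
  apply: measureU; [exact: measurableI|exact: measurableI|].
  apply/seteqP; split => x //= []; rewrite !in_itv/= natrD => -[_ /andP[_ x1]].
  by move=> [_ /andP[x2 _]]; rewrite ltNge x2 in x1.
by rewrite mUn IH lebesgue_measure_periodic_cell// -natr1 EFinD ge0_muleDl ?lee_fin ?ler0n ?mul1e.
Qed.

(** Self-similarity: the stretch by 256 carries the middle band of [0, 1) onto [128, 144), that is,
    onto 16 periods of stage k, so each stage costs a factor 16/256. *)
Lemma lebesgue_measure_cset k :
  mu (cset k `&` `[0, 1[) = (16^-1 ^+ k)%:E :> \bar R.
Proof.
elim: k => [|k IH].
  by rewrite cset0 setTI lebesgue_measure_itv/= lte_fin ltr01 expr0 oppr0 adde0.
have -> : cset k.+1 `&` `[0%R, 1%R[ =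
    (fun x => 256 * x + 0) @^-1` (cset k `&` `[128%:R, 128%:R + 16%:R[).
  apply/seteqP; split => x /=; rewrite csetSl addr0 !in_itv/=.
    move=> -[[/bandP[m xm] xk] x01]; split=> //.
    have m0 : m = 0.
      apply/eqP; rewrite eq_le -ltzD1 -(ltzD1 0 m) -!(ltr_int R) !intrD.
      lra.
    by move: xm; rewrite m0; lra.
  move=> [xk x1]; split; last by lra.
  by split=> //; apply/bandP; exists 0; lra.
rewrite lebesgue_measure_affine; last 2 first.
- by rewrite pnatr_eq0.
- by apply: measurableI => //; exact: measurable_cset.
rewrite lebesgue_measure_periodic; [|exact: measurable_cset|exact: cset_shift].
rewrite IH -!EFinM; congr EFin; rewrite exprS ger0_norm ?ler0n//.
by field.
Qed.

(** The sixteen translates have different first digits, hence are disjoint. They all lie in the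
    rescaled stage k, since 256 a/16 = 16 a is a period of it. *)
Lemma sum_indic_cset_shift k y :
  \sum_(a < 16) \1_(cset k.+1) (y - a%:R / 16) <= \1_(cset k) (256 * y) :> R.
Proof.
have [[a ya]|na] := pselect (exists a : 'I_16, cset k.+1 (y - a%:R / 16)); last first.
  rewrite big1// => a _; rewrite indicE memNset// => ya; apply: na.
  by exists a.
rewrite (bigD1 a)//= big1 ?addr0.
  rewrite !indicE mem_set//= mem_set//.
  move/csetSl: ya => [_]; rewrite -(@cset_shift _ _ _ (16 * a)).
  by congr cset; rewrite natrM; field.
move=> c ca; rewrite indicE memNset// => yc.
have [/bandP[m ym] _] := (csetSl _ _).1 ya.
have [/bandP[n yn] _] := (csetSl _ _).1 yc.
(* Both translates put y in a band with digit 8, so [16 * m + a] and [16 * n + c] are both the floor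
   of 16 y - 8, and a = c modulo 16. *)
have amE : (16 * m + a%:Z)%:~R = 16 * m%:~R + a%:R :> R by rewrite intrD intrM.
have cnE : (16 * n + c%:Z)%:~R = 16 * n%:~R + c%:R :> R by rewrite intrD intrM.
have : (16 * m + a%:Z < 16 * n + c%:Z + 1)%R.
  by rewrite -(ltr_int R) [X in _ < X]intrD amE cnE; lra.
have : (16 * n + c%:Z < 16 * m + a%:Z + 1)%R.
  by rewrite -(ltr_int R) [X in _ < X]intrD amE cnE; lra.
have := ltn_ord a; have := ltn_ord c; move/eqP: ca => ca ? ? ? ?.
by apply: ca; apply/val_inj => /=; lia.
Qed.

End cantor_averages.

(** * Kernel averages of the Cantor set *)

Section cantor_kernel_averages.
Context {R : realType}.
Local Notation mu := (@lebesgue_measure R).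
Implicit Types (q s u v y z : R) (i k l : nat).

Lemma le_pkernel_slack q s t u v y : 0 <= q -> 0 < v -> s <= t ->
  pkernel q s u v y <= pkernel q t u v y.
Proof.
move=> q0 v0 st; rewrite ler_pM2l ?invr_gt0//; apply: ge0_ler_powRN => //.
  by rewrite ltr_wpDr// divr_ge0 ?(ltW v0)// le_max lexx.
rewrite lerD2l ler_pM2r ?invr_gt0// ge_max le_max lexx /=.
by rewrite le_max; apply/orP; right; lra.
Qed.

(** Induction on the stage. The integral is at most that over each of sixteen translates, once the
    flat ball is large enough to absorb the translation; by [sum_indic_cset_shift] the translates
    together fit into stage l one scale finer. Each level thus gains a factor 1/16. *)
Lemma integral_pkernel_cset_slack q u v l i s : 0 <= q -> 0 < v ->
  (\int[mu]_y (\1_(cset l) (pow256 i * y) * pkernel q s u v y)%:E <=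
   (16^-1 ^+ l)%:E * \int[mu]_y (pkernel q (s + (pow256 i)^-1) u v y)%:E)%E.
Proof.
move=> q0 v0; elim: l i s => [|l IH] i s.
  rewrite expr0 mul1e; apply: ge0_le_integral_anyr => y.
    by rewrite mulr_ge0 ?pkernel_ge0.
  rewrite indicE mem_set ?cset0// mul1r; apply: le_pkernel_slack => //.
  by rewrite lerDl invr_ge0 ltW ?pow256_gt0.
set c := pow256 i.
(* The longest translation is 15/16 of a cell and the induction hypothesis uses another 1/256:
   together less than the 256^-i allowed. *)
pose t := s + 15 / 16 / c.
pose g (a : nat) y : R := \1_(cset l.+1) (c * y - a%:R / 16) * pkernel q t u v y.
have mg a : measurable_fun [set: R] (EFin \o g a).
  apply/measurable_EFinP; apply: measurable_funM; last exact: measurable_pkernel.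
  by apply: measurable_indic_affine; exact: measurable_cset.
have g0 a y : 0 <= g a y by rewrite mulr_ge0 ?pkernel_ge0.
set X := (X in (X <= _)%E).
have Xg (a : 'I_16) : (X <= \int[mu]_y (g a y)%:E)%E.
  have a16 : a%:R <= 15 :> R by rewrite ler_nat -ltnS.
  have -> : (\int[mu]_y (g a y)%:E = \int[mu]_y (g a (1 * y + a%:R / 16 / c)%R)%:E)%E.
    rewrite (@ge0_integral_affine R 1 (a%:R / 16 / c) (EFin \o g a)) ?oner_neq0//.
      by rewrite normr1 invr1 mul1e.
    by move=> y; rewrite /= lee_fin.
  apply: ge0_le_integral_anyr => y; first by rewrite mulr_ge0 ?pkernel_ge0.
  rewrite /g mul1r (_ : c * (y + _) - _ = c * y); last first.
    by field; exact: pow256_neq0.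
  rewrite ler_wpM2l//.
  apply: le_trans (le_pkernel_shift s u y (a%:R / 16 / c) q0 v0) _.
  apply: le_pkernel_slack => //; rewrite lerD2l ger0_norm; last first.
    by rewrite !divr_ge0 ?ler0n// ltW// pow256_gt0.
  by rewrite ler_pM2r ?invr_gt0 ?pow256_gt0// ler_pM2r ?invr_gt0.
have X16 : (16%:E * X <= \int[mu]_y (\1_(cset l) (pow256 i.+1 * y) * pkernel q t u v y)%:E)%E.
  have -> : (16%:E * X = \sum_(a < 16) X)%E.
    by rewrite mule_natl sumr_const card_ord.
  apply: (@le_trans _ _ (\sum_(a < 16) \int[mu]_y (g a y)%:E)%E).
    by apply: lee_sum => a _.
  rewrite -ge0_integral_sum//; [|by move=> a; exact: mg|by move=> a y _; rewrite lee_fin].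
  apply: ge0_le_integral_any => y; first by apply: sume_ge0 => a _; rewrite lee_fin.
  rewrite sumEFin lee_fin -mulr_suml ler_wpM2r ?pkernel_ge0//.
  apply: le_trans (sum_indic_cset_shift _ _) _.
  by rewrite pow256S -mulrA.
have step (x y : \bar R) : (16%:E * x <= y -> x <= 16^-1%:E * y)%E.
  by rewrite lee_pdivlMl.
rewrite exprS EFinM -muleA; apply: step; apply: le_trans X16 _.
apply: le_trans (IH _ _) _; apply: lee_wpmul2l; first by rewrite lee_fin exprn_ge0.
apply: ge0_le_integral_anyr => y; first exact: pkernel_ge0.
apply: le_pkernel_slack => //; rewrite /t -addrA lerD2l pow256S invfM -/c.
have ic : 0 < c^-1 by rewrite invr_gt0 pow256_gt0.
by move: (c^-1) ic => d; clear; lra.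
Qed.

(* Averages at a height not below the period of [cset l] cannot tell it from
   its density [16^-l]. *)
Lemma integral_pkernel_cset q u v l i : 1 < q -> (pow256 i)^-1 <= v ->
  (\int[mu]_y (\1_(cset l) (pow256 i * y) * pkernel q 0 u v y)%:E <=
   (16^-1 ^+ l * (2 `^ q * (2 / (q - 1))))%:E)%E.
Proof.
move=> q1 iv; have v0 : 0 < v by apply: lt_le_trans iv; rewrite invr_gt0 pow256_gt0.
have q0 : 0 <= q by lra.
apply: le_trans (integral_pkernel_cset_slack _ _ _ _ q0 v0) _.
rewrite EFinM; apply: lee_wpmul2l; first by rewrite lee_fin exprn_ge0.
rewrite EFinM -(integral_pkernel u q1 v0) -ge0_integralZl ?lee_fin ?powR_ge0//; last 2 first.
- by apply/measurable_EFinP; exact: measurable_pkernel.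
- by move=> y _; rewrite lee_fin pkernel_ge0.
apply: ge0_le_integral_any => y; first by rewrite lee_fin pkernel_ge0.
by rewrite -EFinM lee_fin pkernel_slack// add0r.
Qed.

End cantor_kernel_averages.

(** * The weight and its averages *)

Section cantor_weight.
Context {R : realType}.
Local Notation mu := (@lebesgue_measure R).
Implicit Types (q u v y z : R) (i j k N : nat).

Definition cmult N k : R := if k == N then N%:R else 1.

(* The last stage is counted [N] times: on [0, 1] it then carries as much mass
   as all the others. *)
Definition cweight N y : R :=
  \sum_(k < N.+1) cmult N k * 16 ^+ k * \1_(cset k) y.

Lemma cmult_ge0 N k : 0 <= cmult N k.
Proof. by rewrite /cmult; case: ifP. Qed.

Lemma sum_cmult N : \sum_(k < N.+1) cmult N k = N%:R *+ 2.
Proof.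
rewrite big_ord_recr /= /cmult eqxx (eq_bigr (fun=> 1)); last first.
  by move=> k _; rewrite ltn_eqF.
by rewrite sumr_const card_ord mulr2n.
Qed.

Lemma measurable_cweight N : measurable_fun [set: R] (cweight N).
Proof.
apply: measurable_sum => k; apply: measurable_funM => //.
by apply: measurable_indic; exact: measurable_cset.
Qed.

Lemma cweight_ge N i y : (0 < N)%N -> (i <= N)%N -> cset i y ->
  16 ^+ i <= cweight N y.
Proof.
move=> N0; rewrite -ltnS => iN yi; rewrite /cweight (bigD1 (Ordinal iN))//=.
apply: (@le_trans _ _ (cmult N i * 16 ^+ i * \1_(cset i) y)).
  rewrite indicE mem_set// mulr1 -[leLHS]mul1r ler_wpM2r ?exprn_ge0//.
  by rewrite /cmult; case: ifP => // _; rewrite ler1n.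
by rewrite lerDl; apply: sumr_ge0 => k _; rewrite !mulr_ge0 ?cmult_ge0 ?exprn_ge0.
Qed.

Lemma cweight_ge1 N y : (0 < N)%N -> 1 <= cweight N y.
Proof. by move=> N0; have := @cweight_ge N 0 y N0 isT; rewrite cset0 expr0; apply. Qed.

Lemma cweight_gt0 N y : (0 < N)%N -> 0 < cweight N y.
Proof. by move=> N0; apply: lt_le_trans (cweight_ge1 y N0). Qed.

Lemma cweight_le N y : cweight N y <= (N%:R *+ 2) * 16 ^+ N.
Proof.
rewrite -sum_cmult mulr_suml; apply: ler_sum => k _; rewrite -mulrA.
apply: ler_wpM2l; first exact: cmult_ge0.
apply: (@le_trans _ _ (16 ^+ k)); last first.
  by rewrite ler_eXn2l ?ltr1n// -ltnS.
by rewrite -[leRHS]mulr1 ler_wpM2l ?exprn_ge0// indicE; case: (_ \in _).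
Qed.

Lemma cweight_on N y : (0 < N)%N -> cset N y -> N%:R * 16 ^+ N <= cweight N y.
Proof.
move=> N0 yN; rewrite /cweight big_ord_recr /= indicE mem_set// mulr1.
rewrite /cmult eqxx lerDr; apply: sumr_ge0 => k _.
by rewrite !mulr_ge0 ?cmult_ge0 ?exprn_ge0.
Qed.

Lemma cweight_off N y : (0 < N)%N -> ~ cset 1 y -> cweight N y = 1.
Proof.
move=> N0 y1; rewrite /cweight big_ord_recl/= big1 ?addr0.
  by rewrite /cmult ltn_eqF// indicE cset0 mem_set// expr0 !mulr1.
move=> k _; rewrite indicE memNset ?mulr0// => yk.
by apply: y1; exact: cset_sub yk.
Qed.

Lemma ge0_integral_cweight N (g : R -> R) : measurable_fun [set: R] g ->
  (forall y, 0 <= g y) ->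
  (\int[mu]_y (cweight N y * g y)%:E =
   \sum_(k < N.+1) (cmult N k)%:E *
      ((16 ^+ k)%:E * \int[mu]_y (\1_(cset k) y * g y)%:E))%E.
Proof.
move=> mg g0.
have mkg k : measurable_fun [set: R] (fun y => (\1_(cset k) y * g y)%:E).
  apply/measurable_EFinP; apply: measurable_funM => //.
  by apply: measurable_indic; exact: measurable_cset.
transitivity (\int[mu]_y \sum_(k < N.+1)
    ((cmult N k * 16 ^+ k)%:E * (\1_(cset k) y * g y)%:E))%E.
  apply: eq_integral => y _; rewrite mulr_suml -sumEFin; apply: eq_bigr => k _.
  by rewrite -mulrA EFinM.
have c0 k : (0 <= (cmult N k * 16 ^+ k)%:E)%E.
  by rewrite lee_fin mulr_ge0 ?cmult_ge0 ?exprn_ge0.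
rewrite ge0_integral_sum//; last 2 first.
- by move=> k; exact: (measurable_funeM _ (mkg k)).
- by move=> k y _; apply: mule_ge0 => //; rewrite lee_fin mulr_ge0.
apply: eq_bigr => k _; rewrite ge0_integralZl//; [by rewrite muleA EFinM|exact: mkg|].
by move=> y _; rewrite lee_fin mulr_ge0.
Qed.

(* A disc of height [v] over [u] sees the stage [i]. *)
Definition sees i u v :=
  v <= (pow256 i)^-1 /\ exists2 z, cset i z & pow256 i * `|z - u| < 1.

Lemma reach N u v : exists j, [/\ (j <= N)%N, j = 0%N \/ sees j u v &
  j = N \/ ~ sees j.+1 u v].
Proof.
elim: N => [|N [j [jN j0 j1]]]; first by exists 0%N; split=> //; left.
have [sN|sN] := pselect (sees N.+1 u v); first by exists N.+1; split => //; [right|left].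
case: j1 => [jE|j1]; last by exists j; split => //; [exact: leqW|right].
by exists N; rewrite jE in j0; split => //; right.
Qed.

Lemma powR2_ge1 q : 0 <= q -> 1 <= 2 `^ q :> R.
Proof. by move=> /(ler_powR (ler1n R 2)); rewrite powRr0. Qed.

(** One factor 2^q pays for raising the height, the other for the flat ball; 2 / (q - 1) is the mass
    of the kernel. *)
Definition cst_above q : R := 2 `^ q * (2 `^ q * (2 / (q - 1))).

(** At heights from 256^-i upwards the average of stage k is bounded by the density 16^-(k-i). At
    lower heights, being unseen keeps stage i, hence stage k, at distance at least 256^-i from u, so
    that the height can be raised to 256^-i. *)
Lemma integral_pkernel_unseen q u v i k : 1 < q -> 0 < v -> (i <= k)%N ->
  ~ sees i u v ->
  ((16 ^+ k)%:E * \int[mu]_y (\1_(cset k) y * pkernel q 0 u v y)%:E <=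
   (16 ^+ i * cst_above q)%:E)%E.
Proof.
move=> q1 v0 ik ns.
have q0 : 0 <= q by lra.
have J0 : 0 <= 2 `^ q * (2 / (q - 1)) :> R.
  by rewrite mulr_ge0 ?powR_ge0// divr_ge0// subr_ge0 ltW.
have p1 := powR2_ge1 q0.
(* Only the conditions at the scales i, ..., k - 1 are kept; they form stage k - i rescaled by
   256^i. *)
have low h : (pow256 i)^-1 <= h ->
    (\int[mu]_y (\1_(cset k) y * pkernel q 0 u h y)%:E <=
     (16^-1 ^+ (k - i) * (2 `^ q * (2 / (q - 1))))%:E)%E.
  move=> ih; apply: le_trans (integral_pkernel_cset u (k - i) q1 ih).
  have h0 : 0 < h by apply: lt_le_trans ih; rewrite invr_gt0 pow256_gt0.
  apply: ge0_le_integral_anyr => y; first by rewrite mulr_ge0 ?pkernel_ge0.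
  rewrite ler_wpM2r ?pkernel_ge0// !indicE.
  have [/set_mem yk|] := boolP (y \in cset k) => //.
  rewrite mem_set// => l lki; rewrite mulrA -pow256D.
  by apply: yk; rewrite addnC -ltn_subRL.
have e16 : 16 ^+ k * 16^-1 ^+ (k - i) = 16 ^+ i :> R.
  by rewrite -{1}(subnKC ik) exprD -mulrA -exprMn divff ?expr1n ?mulr1.
rewrite -lee_pdivlMl ?exprn_gt0//.
have -> : ((16 ^+ k)^-1%:E * (16 ^+ i * cst_above q)%:E =
    (2 `^ q)%:E * (16^-1 ^+ (k - i) * (2 `^ q * (2 / (q - 1))))%:E)%E.
  rewrite -!EFinM; congr EFin; rewrite -e16 /cst_above.
  have : 16 ^+ k != 0 :> R by rewrite expf_neq0.
  by move: (16 ^+ k : R) (16^-1 ^+ (k - i) : R) => a b a0; field; lra.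
have [iv|iv] := leP (pow256 i)^-1 v.
  apply: le_trans (low _ iv) _; rewrite -EFinM lee_fin ler_peMl//.
  by rewrite mulr_ge0// exprn_ge0.
pose h : R := (pow256 i)^-1.
have h0 : 0 < h by rewrite invr_gt0 pow256_gt0.
apply: (@le_trans _ _ ((2 `^ q)%:E *
    \int[mu]_y (\1_(cset k) y * pkernel q 0 u h y)%:E)%E); last first.
  by apply: lee_wpmul2l; [rewrite lee_fin powR_ge0|exact: low].
rewrite -ge0_integralZl ?lee_fin ?powR_ge0//; last 2 first.
- apply/measurable_EFinP; apply: measurable_funM; last exact: measurable_pkernel.
  by apply: measurable_indic; exact: measurable_cset.
- by move=> y _; rewrite lee_fin mulr_ge0 ?pkernel_ge0.
apply: ge0_le_integral_any => y; first by rewrite lee_fin mulr_ge0 ?pkernel_ge0.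
rewrite -EFinM lee_fin !indicE.
have [/set_mem yk|_] := boolP (y \in cset k); last by rewrite !mul0r mulr0.
rewrite !mul1r; apply: pkernel_raise => //; [exact: ltW|exact: ltW|].
rewrite leNgt; apply/negP => yu; apply: ns; split; first exact: ltW.
exists y; first exact: cset_sub yk.
by rewrite -ltr_pdivlMl ?pow256_gt0// mulr1.
Qed.

(** Stages up to j are bounded by their coefficient times the mass of the kernel, later ones by
    [integral_pkernel_unseen] at stage j + 1. The multiplicities add up to 2N. *)
Lemma integral_pkernel_cweight q u v N j : 1 < q -> 0 < v ->
  (j <= N)%N -> j = N \/ ~ sees j.+1 u v ->
  (\int[mu]_y (cweight N y * pkernel q 0 u v y)%:E <=
   ((N%:R *+ 2) * (16 ^+ j.+1 * cst_above q))%:E)%E.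
Proof.
move=> q1 v0 jN js.
have q0 : 0 <= q by lra.
rewrite ge0_integral_cweight; [|exact: measurable_pkernel|by move=> y; exact: pkernel_ge0].
rewrite -sum_cmult mulr_suml -sumEFin; apply: lee_sum => k _.
rewrite EFinM; apply: lee_wpmul2l; first by rewrite lee_fin cmult_ge0.
have [kj|jk] := leqP k j; last first.
  case: js => [jE|ns]; last exact: integral_pkernel_unseen.
  by have := leq_trans jk (leq_ord k); rewrite jE ltnn.
apply: (@le_trans _ _ ((16 ^+ k)%:E * (2 / (q - 1))%:E)%E).
  apply: lee_wpmul2l; first by rewrite lee_fin exprn_ge0.
  rewrite -(integral_pkernel u q1 v0); apply: ge0_le_integral_anyr => y.
    by rewrite mulr_ge0 ?pkernel_ge0.
  by rewrite -[leRHS]mul1r ler_wpM2r ?pkernel_ge0// indicE; case: (_ \in _).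
rewrite -EFinM lee_fin ler_pM ?exprn_ge0//.
- by rewrite divr_ge0// subr_ge0 ltW.
- by rewrite ler_eXn2l ?ltr1n// leqW.
have p1 := powR2_ge1 q0.
have c0 : 0 <= 2 / (q - 1) by rewrite divr_ge0// subr_ge0 ltW.
by rewrite /cst_above mulrA ler_peMl// mulr_ege1.
Qed.

End cantor_weight.

(** * Averages of negative powers of the weight *)

Section dual_averages.
Context {R : realType}.
Local Notation mu := (@lebesgue_measure R).
Implicit Types (q u v y z : R) (i j k N : nat).

Lemma pow256_half n : (pow256 n / 4) `^ (2^-1) = 16 ^+ n / 2 :> R.
Proof.
have -> : pow256 n / 4 = (16 ^+ n / 2) ^+ 2 :> R.
  rewrite expr_div_n -exprM mulnC exprM /pow256.
  by congr (_ ^+ _ / _); rewrite expr2 -natrM.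
by rewrite powR12_sqrt ?sqr_ge0// sqrtr_sqr ger0_norm.
Qed.

(** By [cset_near], y lies in stage k < j as soon as |y - z| < 256^-k / 4; i is the last stage
    certified in this way, or 0. *)
Lemma last_common_stage j y z : (0 < j)%N -> cset j z ->
  exists i, [/\ (i < j)%N, cset i y &
    i.+1 = j \/ 1 / 4 <= pow256 i.+1 * `|y - z|].
Proof.
elim: j => // -[|j] IH _ zj; first by exists 0%N; rewrite cset0; split => //; left.
have [i [ij yi]] := IH isT (cset_sub (leqnSn _) zj).
case=> [iE|far]; last by exists i; split => //; [exact: ltnW|right].
have [far|near] := leP (1 / 4) (pow256 i.+1 * `|y - z|).
  by exists i; split => //; [exact: ltnW|right].
exists i.+1; rewrite iE; split => //; last by left.
by apply: cset_near zj _; rewrite -iE.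
Qed.

(* Going away from a point of the Cantor set, the weight decays like the square
   root of the distance, since [16 = sqrt 256]. *)
Lemma inv_cweight_le N j u v y : (0 < N)%N -> 0 < v -> (j <= N)%N ->
  j = 0%N \/ sees j u v ->
  (cweight N y)^-1 <= 32 / 16 ^+ j * (1 + `|y - u| / v) `^ (2^-1).
Proof.
move=> N0 v0 jN js.
have w1 := cweight_ge1 y N0.
have t1 : 1 <= 1 + `|y - u| / v by rewrite lerDl divr_ge0// ltW.
have s1 : 1 <= (1 + `|y - u| / v) `^ (2^-1).
  by rewrite -[leLHS](powRr0 (1 + `|y - u| / v)) ler_powR.
have [j0|j0] := posnP j.
  rewrite j0 expr0 divr1; apply: (@le_trans _ _ 1); first by rewrite invf_le1// (lt_le_trans ltr01).
  by lra.
case: js => [jE|[vj [z zj zu]]]; first by rewrite jE in j0.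
have [i [ij yi]] := last_common_stage y j0 zj.
have wi : (cweight N y)^-1 <= (16 ^+ i)^-1.
  rewrite lef_pV2 ?posrE ?exprn_gt0 ?cweight_gt0//.
  by apply: cweight_ge => //; apply: leq_trans jN; exact: ltnW.
have i0 : 0 < (16 ^+ i)^-1 :> R by rewrite invr_gt0 exprn_gt0.
case=> [iE|far].
  apply: le_trans wi _; rewrite -iE exprS invfM mulrA.
  move: ((16 ^+ i)^-1 : R) i0 ((1 + `|y - u| / v) `^ (2^-1)) s1 => a a0 b b1.
  have : a <= a * b by rewrite ler_peMr// ltW.
  lra.
have jn : (j = i.+1 + (j - i.+1))%N by rewrite subnKC.
set n := (j - i.+1)%N in jn.
(* The n lost stages are paid for by distance: |y - z| is at least 256^n / 4 in units of 256^-j,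
   whereas |z - u| and v are at most one unit. The square root then gives 16^n / 2. *)
have big : pow256 n / 4 <= 1 + `|y - u| / v.
  have pj : pow256 j = pow256 n * pow256 i.+1 :> R by rewrite jn pow256D mulrC.
  have dn : pow256 n / 4 <= pow256 j * `|y - z|.
    by rewrite pj -mulrA ler_wpM2l ?(ltW (pow256_gt0 _))//; move: far; rewrite mul1r.
  have yz : `|y - z| <= `|y - u| + `|z - u|.
    by rewrite [`|z - u|]distrC -(subrKA u) ler_normD.
  have : pow256 j * `|y - z| <= pow256 j * `|y - u| + pow256 j * `|z - u|.
    by rewrite -mulrDr ler_wpM2l ?(ltW (pow256_gt0 _)).
  have : pow256 j * `|y - u| <= `|y - u| / v.
    rewrite mulrC ler_wpM2l// -[leLHS]invrK lef_pV2 ?posrE ?invr_gt0 ?pow256_gt0//.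
  lra.
have : 16 ^+ n / 2 <= (1 + `|y - u| / v) `^ (2^-1).
  rewrite -pow256_half ge0_ler_powR// nnegrE; last by lra.
  by rewrite divr_ge0 ?(ltW (pow256_gt0 _)).
have n0 : 0 < 16 ^+ n :> R by rewrite exprn_gt0.
have -> : 32 / 16 ^+ j = 2 * (16 ^+ i)^-1 / 16 ^+ n :> R.
  rewrite jn exprD exprS; field; rewrite !expf_neq0 ?pnatr_eq0//.
move: (16 ^+ n : R) n0 ((1 + `|y - u| / v) `^ (2^-1)) s1 => m m0 b b1 mb.
apply: le_trans wi _; move: ((16 ^+ i)^-1 : R) i0 => a a0.
have bm : 1 <= 2 * b / m by rewrite ler_pdivlMr//; lra.
have -> : 2 * a / m * b = a * (2 * b / m) by field; exact: lt0r_neq0.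
by rewrite ler_peMr// ltW.
Qed.

Lemma pkernel_mul_powR q r u v y : 0 < v ->
  pkernel q 0 u v y * (1 + `|y - u| / v) `^ r = pkernel (q - r) 0 u v y.
Proof.
move=> v0; rewrite !pkernel0E -mulrA -powRD.
  by congr (_ * _ `^ _); ring.
by apply/implyP => _; rewrite gt_eqF// ltr_wpDr// divr_ge0// ltW.
Qed.

(** By [inv_cweight_le] the power of the weight grows at most with exponent (q - 1)/2 in the
    distance. This is half of the surplus q - 1 of the kernel, so the remaining exponent r = (q +
    1)/2 is still above 1. *)
Lemma integral_pkernel_dual q N j u v : 1 < q -> (0 < N)%N -> 0 < v ->
  (j <= N)%N -> j = 0%N \/ sees j u v ->
  (\int[mu]_y (pkernel q 0 u v y * (cweight N y) `^ (- (q - 1)))%:E <=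
   ((32 / 16 ^+ j) `^ (q - 1) * (4 / (q - 1)))%:E)%E.
Proof.
move=> q1 N0 v0 jN js.
have q10 : 0 < q - 1 by rewrite subr_gt0.
pose r := q - (q - 1) / 2.
have r1 : 1 < r by rewrite /r; lra.
have -> : 4 / (q - 1) = 2 / (r - 1) by rewrite /r; field; lra.
have c0 : 0 <= 32 / 16 ^+ j :> R by rewrite divr_ge0// exprn_ge0.
rewrite EFinM -(integral_pkernel u r1 v0) -ge0_integralZl ?lee_fin ?powR_ge0//; last 2 first.
- by apply/measurable_EFinP; exact: measurable_pkernel.
- by move=> y _; rewrite lee_fin pkernel_ge0.
apply: ge0_le_integral_any => y.
  by rewrite lee_fin mulr_ge0 ?pkernel_ge0 ?powR_ge0.
rewrite -EFinM lee_fin -pkernel_mul_powR// mulrCA ler_wpM2l ?pkernel_ge0//.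
have t0 : 0 <= (1 + `|y - u| / v) `^ (2^-1) by exact: powR_ge0.
rewrite mulrC [(q - 1) / 2]mulrC powRrM [leRHS]mulrC -powRM//.
rewrite powRN -powR_inv1 ?powR_ge0// powRAC powR_inv1 ?(ltW (cweight_gt0 _ _))//.
rewrite ge0_ler_powR ?nnegrE ?invr_ge0 ?(ltW q10) ?(ltW (cweight_gt0 _ _)) ?mulr_ge0//.
exact: inv_cweight_le.
Qed.

End dual_averages.

(** * The fattened characteristic *)

Section fat_characteristic.
Context {R : realType}.
Local Notation mu := (@lebesgue_measure R).
Implicit Types (p q u v x y : R) (l : R[i]) (j k N : nat).

Lemma normc_bounds u v x : 0 < v ->
  (v + `|x - u|) / 2 <= ComplexField.Normc.normc (x%:C%C - (u +i* v)%C) <= v + `|x - u|.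
Proof.
move=> v0; rewrite /= sub0r sqrrN -[(x - u) ^+ 2]real_normK ?num_real//.
have d0 := normr_ge0 (x - u); move: `|x - u| d0 => d d0.
have s0 : 0 <= v + d by rewrite addr_ge0// ltW.
apply/andP; split.
  rewrite -[leLHS]ger0_norm ?divr_ge0// -sqrtr_sqr ler_wsqrtr//.
  rewrite expr_div_n; have := sqr_ge0 (v - d).
  have := sqr_ge0 v; have := sqr_ge0 d; rewrite sqrrB sqrrD; lra.
rewrite -[leRHS]ger0_norm// -sqrtr_sqr ler_wsqrtr// sqrrD.
have := mulr_ge0 (ltW v0) d0; lra.
Qed.

Lemma fat_kernel_bounds q u v x : 0 <= q -> 0 < v ->
  pkernel q 0 u v x <= fat_kernel q (u +i* v)%C x <= 2 `^ q * pkernel q 0 u v x.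
Proof.
move=> q0 v0; rewrite pkernel0E kernel_powR_split// /fat_kernel.
have := normc_bounds u x v0; rewrite [complex.Im _]/=.
move: (ComplexField.Normc.normc _) => n /andP[n1 n2].
have s0 : 0 < v + `|x - u| by rewrite ltr_pwDl.
have n0 : 0 < n by apply: lt_le_trans n1; rewrite divr_gt0.
rewrite -powRN mulrCA !ler_wpM2l ?powR_ge0//=; last exact: ge0_ler_powRN.
have -> : 2 `^ q = 2^-1 `^ (- q) :> R by rewrite -powR_inv1// -powRrM mulrNN mul1r.
rewrite -powRM ?(ltW s0)//; apply: ge0_ler_powRN => //; first by rewrite mulr_gt0.
by rewrite mulrC.
Qed.

Lemma fat_kernel_ge0 q u v x : 0 <= q -> 0 < v -> 0 <= fat_kernel q (u +i* v)%C x.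
Proof.
by move=> q0 v0; have /andP[+ _] := fat_kernel_bounds u x q0 v0;
  apply: le_trans; exact: pkernel_ge0.
Qed.

Lemma integral_fat_kernel_le q u v (w : R -> R) : 0 <= q -> 0 < v ->
  measurable_fun [set: R] w -> (forall x, 0 <= w x) ->
  (\int[mu]_x (fat_kernel q (u +i* v)%C x * w x)%:E <=
   (2 `^ q)%:E * \int[mu]_x (w x * pkernel q 0 u v x)%:E)%E.
Proof.
move=> q0 v0 mw w0.
rewrite -ge0_integralZl ?lee_fin ?powR_ge0//; last 2 first.
- by apply/measurable_EFinP; apply: measurable_funM => //; exact: measurable_pkernel.
- by move=> x _; rewrite lee_fin mulr_ge0 ?pkernel_ge0.
apply: ge0_le_integral_any => x; first by rewrite lee_fin mulr_ge0 ?fat_kernel_ge0.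
rewrite -EFinM lee_fin mulrCA mulrC ler_wpM2l//.
by have /andP[] := fat_kernel_bounds u x q0 v0.
Qed.

(** Here 32 = 2 * 16: the multiplicities add up to 2N, and the bound is taken at stage j + 1. *)
Definition cst_weight q : R := 2 `^ q * (32 * cst_above q).
Definition cst_dual q : R := 2 `^ q * (4 / (q - 1)).

Lemma cst_weight_ge0 q : 1 < q -> 0 <= cst_weight q.
Proof.
move=> q1; rewrite /cst_weight /cst_above !mulr_ge0 ?powR_ge0 ?invr_ge0//.
by rewrite subr_ge0 ltW.
Qed.

Lemma cst_dual_ge0 q : 1 < q -> 0 <= cst_dual q.
Proof.
by move=> q1; rewrite !mulr_ge0 ?powR_ge0 ?invr_ge0// subr_ge0 ltW.
Qed.

Lemma integral_fat_cweight q u v N j : 1 < q -> 0 < v -> (j <= N)%N ->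
  j = N \/ ~ sees j.+1 u v ->
  (\int[mu]_x (fat_kernel q (u +i* v)%C x * cweight N x)%:E <=
   (cst_weight q * (N%:R * 16 ^+ j))%:E)%E.
Proof.
move=> q1 v0 jN js; have q0 : 0 <= q by lra.
apply: le_trans (integral_fat_kernel_le _ q0 v0 (measurable_cweight N) _) _.
  by move=> x; apply: sumr_ge0 => k _; rewrite !mulr_ge0 ?cmult_ge0 ?exprn_ge0.
apply: (@le_trans _ _ ((2 `^ q)%:E * (N%:R *+ 2 * (16 ^+ j.+1 * cst_above q))%:E)%E).
  by apply: lee_wpmul2l; [rewrite lee_fin powR_ge0|exact: integral_pkernel_cweight].
by rewrite -EFinM lee_fin /cst_weight exprS le_eqVlt; apply/orP; left; apply/eqP; ring.
Qed.

Lemma integral_fat_dual q u v N j : 1 < q -> (0 < N)%N -> 0 < v -> (j <= N)%N ->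
  j = 0%N \/ sees j u v ->
  (\int[mu]_x (fat_kernel q (u +i* v)%C x * cweight N x `^ (- (q - 1)))%:E <=
   (cst_dual q * (32 / 16 ^+ j) `^ (q - 1))%:E)%E.
Proof.
move=> q1 N0 v0 jN js; have q0 : 0 <= q by lra.
apply: le_trans (integral_fat_kernel_le _ q0 v0 _ _) _.
- by apply: (measurableT_comp (measurable_powR _)); exact: measurable_cweight.
- by move=> x; exact: powR_ge0.
under eq_integral do rewrite mulrC.
apply: (@le_trans _ _ ((2 `^ q)%:E * ((32 / 16 ^+ j) `^ (q - 1) * (4 / (q - 1)))%:E)%E).
  by apply: lee_wpmul2l; [rewrite lee_fin powR_ge0|exact: integral_pkernel_dual].
by rewrite -EFinM lee_fin /cst_dual mulrAC mulrA.
Qed.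

Lemma indic_unit_fat_kernel q x : 0 <= q ->
  2 `^ (- q) * \1_`[0, 1[%classic x <= fat_kernel q (0 +i* 1)%C x.
Proof.
move=> q0; have /andP[+ _] := fat_kernel_bounds 0 x q0 (@ltr01 R).
apply: le_trans; rewrite indicE.
have [/set_mem|_] := boolP (x \in _); last by rewrite mulr0 pkernel_ge0.
rewrite /= in_itv/= => /andP[x0 x1].
rewrite mulr1 pkernel0E invr1 mul1r subr0 mulr1 ger0_norm//.
by apply: ge0_ler_powRN => //; lra.
Qed.

(** Each stage contributes exactly its multiplicity, as its coefficient 16^k cancels its density. *)
Lemma integral_cweight_unit N :
  (\int[mu]_x (cweight N x * \1_`[0%R, 1%R[%classic x)%:E = (N%:R *+ 2)%:E)%E.
Proof.
rewrite ge0_integral_cweight//.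
rewrite -sum_cmult -sumEFin; apply: eq_bigr => k _.
have -> : (\int[mu]_x (\1_(cset k) x * \1_`[0%R, 1%R[%classic x)%:E =
    (16^-1 ^+ k)%:E)%E.
  rewrite -lebesgue_measure_cset -[in RHS](setIT (_ `&` _)) -integral_indic//.
    by apply: eq_integral => x _; rewrite indicI.
  by apply: measurableI => //; exact: measurable_cset.
by rewrite -!EFinM -exprMn divff ?pnatr_eq0// expr1n mulr1.
Qed.

Lemma ge0_integral_fat_lower q N : 0 <= q ->
  ((2 `^ (- q) * (N%:R *+ 2))%:E <=
   \int[mu]_x (fat_kernel q (0 +i* 1)%C x * cweight N x)%:E)%E.
Proof.
move=> q0.
have w0 x : 0 <= cweight N x.
  by apply: sumr_ge0 => k _; rewrite !mulr_ge0 ?cmult_ge0 ?exprn_ge0.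
rewrite EFinM -integral_cweight_unit -ge0_integralZl ?lee_fin ?powR_ge0//; last 2 first.
- apply/measurable_EFinP; apply: measurable_funM; first exact: measurable_cweight.
  exact: measurable_indic.
- by move=> x _; rewrite lee_fin mulr_ge0.
apply: ge0_le_integral_any => x.
  by rewrite -EFinM lee_fin !mulr_ge0 ?powR_ge0.
rewrite -EFinM lee_fin mulrCA mulrC; apply: ler_wpM2r => //.
exact: indic_unit_fat_kernel.
Qed.

Lemma cset1_half x : cset 1 x -> ~ `[0, 1 / 2[%classic x.
Proof.
move=> /(_ 0%N isT); rewrite pow256_0 mul1r => /bandP[m xm] /=; rewrite in_itv/= => x0.
have m0 : (0 < m + 1) by rewrite -(ltr_int R) intrD; lra.
have m1 : (m < 0) by rewrite -(ltr_int R); lra.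
lia.
Qed.

(** The weight equals 1 on [0, 1/2), which misses stage 1, so its powers are 1 there whatever the
    exponent. *)
Lemma ge0_integral_fat_dual_lower q r N : 0 <= q -> (0 < N)%N ->
  ((2 `^ (- q) * (1 / 2))%:E <=
   \int[mu]_x (fat_kernel q (0 +i* 1)%C x * cweight N x `^ r)%:E)%E.
Proof.
move=> q0 N0.
rewrite EFinM.
have -> : (1 / 2 : R)%:E = (\int[mu]_x (\1_`[0%R, (1 / 2)%R[%classic x)%:E)%E.
  have e : mu `[0, 1 / 2[%classic = (1 / 2)%:E.
    by rewrite lebesgue_measure_itv/= lte_fin divr_gt0// oppr0 adde0.
  by rewrite integral_indic// setIT; exact/esym.
rewrite -ge0_integralZl ?lee_fin ?powR_ge0//; last first.
  by apply/measurable_EFinP; exact: measurable_indic.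
apply: ge0_le_integral_any => x; first by rewrite -EFinM lee_fin mulr_ge0 ?powR_ge0.
rewrite -EFinM lee_fin [in leLHS]indicE.
have [/set_mem xh|_] := boolP (x \in _); last first.
  by rewrite mulr0 mulr_ge0 ?powR_ge0// fat_kernel_ge0.
rewrite cweight_off//; last by move=> /cset1_half.
rewrite powR1 !mulr1; apply: le_trans (indic_unit_fat_kernel x q0).
rewrite indicE mem_set ?mulr1//=; move: xh; rewrite /= !in_itv/=; lra.
Qed.

End fat_characteristic.

(** * Two-sided bounds for both families of weights *)

Section fat_Ap_bounds.
Context {R : realType}.
Local Notation mu := (@lebesgue_measure R).
Implicit Types (p q u v x y : R) (j k N : nat).

Lemma conjugate_sub1 p : 1 < p -> p / (p - 1) - 1 = (p - 1)^-1.
Proof. by move=> p1; field; rewrite subr_eq0 gt_eqF. Qed.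

Lemma conjugate_gt1 p : 1 < p -> 1 < p / (p - 1).
Proof. by move=> p1; rewrite -subr_gt0 conjugate_sub1// invr_gt0 subr_gt0. Qed.

Lemma le_mule_poweR (X Y : \bar R) (a b r : R) : 0 <= r -> (0 <= X)%E -> (0 <= Y)%E ->
  (X <= a%:E)%E -> (Y <= b%:E)%E -> (X * Y `^ r <= (a * b `^ r)%:E)%E.
Proof.
move=> r0 X0 Y0 Xa Yb; rewrite EFinM -poweR_EFin; apply: lee_pmul => //.
  exact: poweR_ge0.
by apply: gt0_ler_poweR => //; rewrite in_itv/= ?leey ?andbT// (le_trans Y0).
Qed.

Lemma ge_mule_poweR (X Y : \bar R) (a b r : R) : 0 <= r -> 0 <= a -> 0 <= b ->
  (a%:E <= X)%E -> (b%:E <= Y)%E -> ((a * b `^ r)%:E <= X * Y `^ r)%E.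
Proof.
move=> r0 a0 b0 aX bY; rewrite EFinM -poweR_EFin; apply: lee_pmul => //.
  exact: poweR_ge0.
have Y0 : (0 <= Y)%E by apply: le_trans bY; rewrite lee_fin.
by apply: gt0_ler_poweR => //; rewrite in_itv/= ?leey ?andbT ?lee_fin.
Qed.

Lemma fat_Ap_le p (w : R -> R) (c : R) :
  (forall u v, 0 < v ->
    ((\int[mu]_x (fat_kernel p (u +i* v)%C x * w x)%:E) *
     (\int[mu]_x (fat_kernel (p / (p - 1)) (u +i* v)%C x * w x `^ (- (p - 1)^-1))%:E)
       `^ (p - 1) <= c%:E)%E) -> (fat_Ap p w <= c%:E)%E.
Proof. by move=> h; apply: ge_ereal_sup => _ [[u v] /= v0 <-]; exact: h. Qed.

Lemma fat_Ap_ge p (w : R -> R) :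
    ((\int[mu]_x (fat_kernel p (0 +i* 1)%C x * w x)%:E) *
     (\int[mu]_x (fat_kernel (p / (p - 1)) (0 +i* 1)%C x * w x `^ (- (p - 1)^-1))%:E)
       `^ (p - 1) <= fat_Ap p w)%E.
Proof. by apply: ereal_sup_ubound; exists (0 +i* 1)%C => //=; exact: ltr01. Qed.

(** Since p' - 1 = 1/(p - 1), this is the dual weight of [cweight N] with respect to the exponent
    p'. *)
Definition dual_cweight p N x : R := cweight N x `^ (- (p - 1)).

Lemma dual_cweightK p N x : 1 < p -> (0 < N)%N ->
  dual_cweight p N x `^ (- (p - 1)^-1) = cweight N x.
Proof.
move=> p1 N0; rewrite /dual_cweight -powRrM mulrNN mulfV ?powRr1//.
  by rewrite ltW// cweight_gt0.
by rewrite subr_eq0 gt_eqF.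
Qed.

Lemma integral_fat_ge0 q u v (w : R -> R) : 0 <= q -> 0 < v -> (forall x, 0 <= w x) ->
  (0 <= \int[mu]_x (fat_kernel q (u +i* v)%C x * w x)%:E)%E.
Proof.
by move=> q0 v0 w0; apply: integral_ge0 => x _; rewrite lee_fin mulr_ge0 ?fat_kernel_ge0.
Qed.

(** For the stage j given by [reach] the two factors are at most of order N 16^j and 16^-j, so the
    stage cancels. *)
Lemma fat_Ap_cweight_le p : 1 < p -> exists C : R, forall N, (0 < N)%N ->
  (fat_Ap p (cweight N) <= (C * N%:R)%:E)%E.
Proof.
move=> p1; have p'1 := conjugate_gt1 p1; have p'E := conjugate_sub1 p1.
have p10 : 0 < p - 1 by rewrite subr_gt0.
set p' := p / (p - 1) in p'1 p'E.
exists (cst_weight p * (cst_dual p' `^ (p - 1) * 32)) => N N0; apply: fat_Ap_le => u v v0.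
have [j [jN jl ju]] := reach N u v.
have := integral_fat_cweight p1 v0 jN ju.
have := integral_fat_dual p'1 N0 v0 jN jl.
rewrite -/p' p'E => Yb Xa.
have j0 : 0 < 16 ^+ j :> R by rewrite exprn_gt0.
have d0 : 0 <= 32 / 16 ^+ j :> R by rewrite divr_ge0// ltW.
apply: le_trans (le_mule_poweR (ltW p10) _ _ Xa Yb) _.
- by apply: integral_fat_ge0 => //; [lra|move=> x; rewrite ltW ?cweight_gt0].
- by apply: integral_fat_ge0 => //; [lra|move=> x; exact: powR_ge0].
rewrite lee_fin powRM ?cst_dual_ge0 ?powR_ge0// -powRrM mulVf ?gt_eqF// powRr1//.
rewrite le_eqVlt; apply/orP; left; apply/eqP.
move: (16 ^+ j : R) j0 (cst_dual p' `^ (p - 1)) => a a0 b; field; exact: lt0r_neq0.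
Qed.

(** The point i of the half-plane suffices: on the unit interval the weight has mass 2N, and the
    dual factor is bounded below by a constant. *)
Lemma fat_Ap_cweight_ge p : 1 < p -> exists2 c : R, 0 < c & forall N, (0 < N)%N ->
  ((c * N%:R)%:E <= fat_Ap p (cweight N))%E.
Proof.
move=> p1; have p'1 := conjugate_gt1 p1.
have p10 : 0 < p - 1 by rewrite subr_gt0.
set p' := p / (p - 1) in p'1.
exists (2 `^ (- p) * 2 * (2 `^ (- p') * (1 / 2)) `^ (p - 1)).
  by rewrite !(mulr_gt0, powR_gt0, divr_gt0).
move=> N N0; apply: le_trans (fat_Ap_ge _ _).
have q0 : 0 <= p by lra.
have q'0 : 0 <= p' by lra.
have Xa := ge0_integral_fat_lower N q0.
have Yb := ge0_integral_fat_dual_lower (- (p - 1)^-1) q'0 N0.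
apply: le_trans (ge_mule_poweR (ltW p10) _ _ Xa Yb).
- by rewrite lee_fin le_eqVlt; apply/orP; left; apply/eqP; ring.
- by rewrite mulr_ge0 ?powR_ge0// mulrn_wge0.
- by rewrite mulr_ge0 ?powR_ge0.
Qed.

(** The two factors have traded places, and now N 16^j is raised to the power p - 1. *)
Lemma fat_Ap_dual_le p : 1 < p -> exists C : R, forall N, (0 < N)%N ->
  (fat_Ap p (dual_cweight p N) <= (C * N%:R `^ (p - 1))%:E)%E.
Proof.
move=> p1; have p'1 := conjugate_gt1 p1.
have p10 : 0 < p - 1 by rewrite subr_gt0.
set p' := p / (p - 1) in p'1.
exists (cst_dual p * 32 `^ (p - 1) * cst_weight p' `^ (p - 1)) => N N0; apply: fat_Ap_le => u v v0.
have [j [jN jl ju]] := reach N u v.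
have Xa := integral_fat_dual p1 N0 v0 jN jl.
have Yb := integral_fat_cweight p'1 v0 jN ju.
under [X in (_ * X `^ _)%E]eq_integral do rewrite dual_cweightK//.
have j0 : 0 < 16 ^+ j :> R by rewrite exprn_gt0.
apply: le_trans (le_mule_poweR (ltW p10) _ _ Xa Yb) _.
- by apply: integral_fat_ge0 => //; [lra|move=> x; exact: powR_ge0].
- by apply: integral_fat_ge0 => //; [lra|move=> x; rewrite ltW ?cweight_gt0].
have p'0 : 0 <= p' - 1 by rewrite subr_ge0 ltW.
rewrite lee_fin !powRM ?(cst_weight_ge0 p'1) ?mulr_ge0 ?invr_ge0 ?(ltW j0)//.
rewrite -(powR_inv1 (ltW j0)) powRAC powR_inv1 ?powR_ge0//.
rewrite le_eqVlt; apply/orP; left; apply/eqP.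
have : 0 < (16 ^+ j) `^ (p - 1) :> R by rewrite powR_gt0.
move: ((16 ^+ j) `^ (p - 1) : R) (32 `^ (p - 1)) => a b a0; field; exact: lt0r_neq0.
Qed.

Lemma fat_Ap_dual_ge p : 1 < p -> exists2 c : R, 0 < c & forall N, (0 < N)%N ->
  ((c * N%:R `^ (p - 1))%:E <= fat_Ap p (dual_cweight p N))%E.
Proof.
move=> p1; have p'1 := conjugate_gt1 p1.
have p10 : 0 < p - 1 by rewrite subr_gt0.
set p' := p / (p - 1) in p'1.
exists (2 `^ (- p) * (1 / 2) * (2 `^ (- p') * 2) `^ (p - 1)).
  by rewrite !(mulr_gt0, powR_gt0, divr_gt0).
move=> N N0; apply: le_trans (fat_Ap_ge _ _).
under [X in (_ <= _ * X `^ _)%E]eq_integral do rewrite dual_cweightK//.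
have q0 : 0 <= p by lra.
have q'0 : 0 <= p' by lra.
have Xa := ge0_integral_fat_dual_lower (- (p - 1)) q0 N0.
have Yb := ge0_integral_fat_lower N q'0.
apply: le_trans (ge_mule_poweR (ltW p10) _ _ Xa Yb).
- have -> : 2 `^ (- p') * (N%:R *+ 2) = 2 `^ (- p') * 2 * N%:R :> R by ring.
  by rewrite [in leRHS]powRM ?mulr_ge0 ?powR_ge0// mulrA.
- by rewrite mulr_ge0 ?powR_ge0.
- by rewrite mulr_ge0 ?powR_ge0// mulrn_wge0.
Qed.

End fat_Ap_bounds.

(** * Principal values *)

Section principal_value.
Context {R : realType}.
Local Notation mu := (@lebesgue_measure R).
Implicit Types (f : R -> R) (e eta s x y : R).

(** The truncation is put into the kernel, which becomes bounded and odd, and all integrals run over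
    the whole line. *)
Definition cut_inv e s : R := if e < `|s| then s^-1 else 0.

Lemma cut_invN e s : cut_inv e (- s) = - cut_inv e s.
Proof. by rewrite /cut_inv normrN invrN; case: ifP => //; rewrite oppr0. Qed.

Lemma norm_cut_inv e s : 0 < e -> `|cut_inv e s| <= e^-1.
Proof.
move=> e0; rewrite /cut_inv; case: ifPn => [es|_]; last by rewrite normr0 invr_ge0 ltW.
by rewrite normfV lef_pV2 ?posrE ?ltW// (lt_trans e0).
Qed.

Lemma measurable_cut_inv e : measurable_fun [set: R] (cut_inv e).
Proof.
(* Writing 1/s as s |s|^-2 reduces measurability to that of real powers; at s = 0 both sides are
   0. *)
have -> : cut_inv e = (fun s : R => if e < `|s| then s * `|s| `^ (- 2) else 0).
  apply/funext => s; rewrite /cut_inv; case: ifP => // _.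
  rewrite powR_invn// real_normK ?num_real//.
  have [->|s0] := eqVneq s 0; first by rewrite invr0 mul0r.
  by rewrite expr2 invfM mulrA divff// mul1r.
apply: measurable_fun_ifT => //.
  by apply: measurable_fun_ltr => //; exact: normr_measurable.
apply: measurable_funM => //; apply: (measurableT_comp (measurable_powR _)).
exact: normr_measurable.
Qed.

Lemma measurable_cut_inv_sub e x : measurable_fun [set: R] (fun y => cut_inv e (x - y)).
Proof.
by apply: (measurableT_comp (measurable_cut_inv e)); apply: measurable_funB.
Qed.

Lemma integrable_cut_inv f e x : 0 < e -> mu.-integrable [set: R] (EFin \o f) ->
  mu.-integrable [set: R] (fun y => (f y * cut_inv e (x - y))%:E).
Proof.
move=> e0 intf; have /measurable_EFinP mf := measurable_int _ intf.
have h : mu.-integrable [set: R] (fun y => e^-1%:E * (f y)%:E)%E.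
  exact: integrableZl.
apply: (le_integrable measurableT _ _ h).
- apply/measurable_EFinP; apply: measurable_funM => //.
  exact: measurable_cut_inv_sub.
- move=> y _; rewrite -EFinM !abse_EFin lee_fin !normrM mulrC.
  by rewrite ler_wpM2r// (le_trans (norm_cut_inv _ e0))// ler_norm.
Qed.

Lemma hilbert_truncE f x e : 0 <= e ->
  hilbert_trunc f x e = \int[mu]_y (f y * cut_inv e (x - y)).
Proof.
move=> e0; rewrite /hilbert_trunc Rintegral_mkcond; apply: eq_Rintegral => y _.
rewrite patchE /cut_inv; case: ifPn => [/set_mem /= ->//|].
by move=> /negP ye; rewrite ifF ?mulr0//; apply/negbTE/negP => exy; apply: ye; exact/mem_set.
Qed.

Lemma integrable_hilbert_kernel f x e : 0 < e -> mu.-integrable [set: R] (EFin \o f) ->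
  mu.-integrable [set y | e < `|x - y|] (fun y => (f y / (x - y))%:E).
Proof.
move=> e0 intf.
have mD : measurable [set y : R | e < `|x - y|].
  rewrite -[X in measurable X]setTI.
  have : measurable_fun [set: R] (fun y => e < `|x - y|).
    apply: measurable_fun_ltr => //; apply: measurableT_comp; first exact: normr_measurable.
    exact: measurable_funB.
  by move=> /(_ measurableT [set true] Logic.I); rewrite /preimage /=.
apply: (@eq_integrable _ _ _ mu _ mD (fun y => (f y * cut_inv e (x - y))%:E)) => //.
  by move=> y /set_mem /= exy; rewrite /cut_inv exy.
by apply: integrableS (integrable_cut_inv x e0 intf).
Qed.

Lemma integrable_cut_inv_diff x e eta : 0 < e -> e <= eta ->
  mu.-integrable [set: R] (fun y => (cut_inv e (x - y) - cut_inv eta (x - y))%:E).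
Proof.
move=> e0 eeta.
have c0 : 0 <= e^-1 + eta^-1.
  by rewrite addr_ge0// invr_ge0 ?(ltW e0)// (le_trans (ltW e0)).
have h : mu.-integrable [set: R]
    (fun y => (e^-1 + eta^-1)%:E * (\1_`[x - eta, x + eta]%classic y)%:E)%E.
  by apply: integrableZl => //; exact: integrable_indic_itv.
apply: (le_integrable measurableT _ _ h).
- apply/measurable_EFinP.
  by apply: measurable_funB; exact: measurable_cut_inv_sub.
- move=> y _; rewrite -EFinM !abse_EFin lee_fin indicE.
  have [yx|yx] := boolP (y \in _).
    rewrite mulr1 [leRHS]ger0_norm//; apply: le_trans (ler_normB _ _) _.
    by rewrite lerD// norm_cut_inv// (lt_le_trans e0).
  have far : eta < `|x - y|.
    rewrite ltNge; apply: contra yx => yx; apply/mem_set => /=.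
    by rewrite in_itv/= -ler_distlC.
  by rewrite /cut_inv far (le_lt_trans eeta far) subrr !normr0.
Qed.

(* Odd cancellation around [x]. *)
Lemma Rintegral_cut_inv_diff x e eta : 0 < e -> e <= eta ->
  \int[mu]_y (cut_inv e (x - y) - cut_inv eta (x - y)) = 0.
Proof.
move=> e0 eeta; have intk := integrable_cut_inv_diff x e0 eeta.
pose k y := cut_inv e (x - y) - cut_inv eta (x - y).
have kN y : k (- 1 * y + (x *+ 2)) = - k y.
  rewrite /k (_ : x - _ = - (x - y)); last by ring.
  by rewrite !cut_invN; ring.
have : (\int[mu]_y (k y)%:E = - \int[mu]_y (k y)%:E)%E.
  have := @integral_affine R (-1) (x *+ 2) (EFin \o k).
  rewrite oppr_eq0 oner_eq0 normrN1 invr1 mul1e => /(_ isT intk) h.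
  rewrite -{1}h -integralN; last first.
    by apply: fin_num_adde_defr; exact: integrable_pos_fin_num.
  by apply: eq_integral => y _; rewrite /= kN EFinN.
have /fineK <- := integrable_fin_num measurableT intk.
rewrite -EFinN => -[] h; rewrite /Rintegral.
have : fine (\int[mu]_y (k y)%:E) = 0 by lra.
by [].
Qed.

(** The truncations differ only by the part with e < |x - y| <= eta, where f is constant and the odd
    kernel integrates to 0. *)
Lemma hilbert_trunc_loc_const f x e eta : 0 < e -> e <= eta ->
  mu.-integrable [set: R] (EFin \o f) ->
  (forall y, `|x - y| <= eta -> f y = f x) ->
  hilbert_trunc f x e = hilbert_trunc f x eta.
Proof.
move=> e0 eeta intf fx; have eta0 := lt_le_trans e0 eeta.
apply/eqP; rewrite -subr_eq0 !hilbert_truncE ?ltW//; apply/eqP.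
rewrite -RintegralB//; [|exact: integrable_cut_inv..].
rewrite -[RHS](mulr0 (f x)) -(Rintegral_cut_inv_diff x e0 eeta) -RintegralZl//; last first.
  exact: integrable_cut_inv_diff.
apply: eq_Rintegral => y _; rewrite -mulrBr.
have [/fx ->//|h] := leP `|x - y| eta.
by rewrite /cut_inv h (le_lt_trans eeta h) subrr !mulr0.
Qed.

(** The truncations are constant for small radii, so the principal value exists and equals an
    absolutely convergent integral. All later computations use that integral. *)
Lemma hilbert_loc_const f x eta : 0 < eta ->
  mu.-integrable [set: R] (EFin \o f) ->
  (forall y, `|x - y| <= eta -> f y = f x) ->
  has_hilbert f x /\ hilbert f x = \int[mu]_y (f y * cut_inv eta (x - y)).
Proof.
move=> eta0 intf fx.
have cv : hilbert_trunc f x e @[e --> 0^'+] --> hilbert_trunc f x eta.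
  apply: cvg_near_cst; near=> e; apply: hilbert_trunc_loc_const => //.
  by near: e; apply: nbhs_right_le.
rewrite -hilbert_truncE ?ltW//; split; last exact: cvg_lim cv.
split; first by move=> e e0; exact: integrable_hilbert_kernel.
by apply/cvg_ex; exists (hilbert_trunc f x eta).
Unshelve. all: by end_near. Qed.

(** The exceptional null set is the countable grid of multiples of 256^-N; off it f is constant
    around x. *)
Lemma has_hilbert_grid f N : mu.-integrable [set: R] (EFin \o f) ->
  (forall x y, Num.floor (pow256 N * x) = Num.floor (pow256 N * y) -> f x = f y) ->
  {ae mu, forall x, has_hilbert f x}.
Proof.
move=> intf fN.
exists [set (m%:~R / pow256 N : R) | m in [set: int]].
have cG : countable [set (m%:~R / pow256 N : R) | m in [set: int]].
  by apply: sub_countable (card_image_le _ _) _.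
split; first exact: countable_measurable.
  exact: countable_lebesgue_measure0.
move=> x /= nx; apply: contrapT => xG; apply: nx.
have [m [m0 m1 xm]] : exists m : int, [/\ m%:~R < pow256 N * x,
    pow256 N * x < m%:~R + 1 & Num.floor (pow256 N * x) = m].
  have /andP[l1 l2] := floor_itv (pow256 N * x); rewrite intrD in l2.
  exists (Num.floor (pow256 N * x)); split => //.
  rewrite lt_neqAle l1 andbT; apply/eqP => mE; apply: xG.
  by exists (Num.floor (pow256 N * x)) => //; rewrite mE mulrC mulKf// pow256_neq0.
pose d := Num.min (pow256 N * x - m%:~R) (m%:~R + 1 - pow256 N * x).
have d0 : 0 < d by rewrite lt_min !subr_gt0 m0.
have d1 : d <= pow256 N * x - m%:~R by rewrite ge_min lexx.
have d2 : d <= m%:~R + 1 - pow256 N * x by rewrite ge_min lexx orbT.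
have p0 := @pow256_gt0 R N.
have [] // := @hilbert_loc_const f x (d / 2 / pow256 N) _ intf; first by rewrite !divr_gt0.
move=> y; rewrite ler_pdivlMr// mulrC -{1}(gtr0_norm p0) -normrM mulrBr => xy.
apply: fN; rewrite xm; apply/eqP; rewrite floor_eq intrD.
move: xy; rewrite ler_norml; lra.
Qed.

End principal_value.

(** * The test function *)

Section dipoles.
Context {R : realType}.
Local Notation mu := (@lebesgue_measure R).
Implicit Types (e eta s x y z : R) (k m n b : nat).

Definition part b k : set R :=
  `[0, 1[ `&` (cset k `&` [set x | band b (pow256 k * x)]).

Definition dipoles n y : R := \sum_(k < n) (\1_(part 7 k) y - \1_(part 9 k) y).

Lemma measurable_part b k : measurable (part b k).
Proof.
apply: measurableI => //; apply: measurableI; first exact: measurable_cset.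
by apply: measurable_scale_preimage; exact: measurable_band.
Qed.

Lemma measurable_dipoles n : measurable_fun [set: R] (dipoles n).
Proof.
apply: measurable_sum => k; apply: measurable_funB; apply: measurable_indic;
  exact: measurable_part.
Qed.

Lemma band_inj b c x : (b < 16)%N -> (c < 16)%N -> band b x -> band c x -> b = c.
Proof.
move=> b16 c16 /bandP[m xm] /bandP[n xn].
have bE : (16 * m + b%:Z)%:~R = 16 * m%:~R + b%:R :> R by rewrite intrD intrM.
have cE : (16 * n + c%:Z)%:~R = 16 * n%:~R + c%:R :> R by rewrite intrD intrM.
have : (16 * m + b%:Z < 16 * n + c%:Z + 1)%R.
  by rewrite -(ltr_int R) [X in _ < X]intrD bE cE; lra.
have : (16 * n + c%:Z < 16 * m + b%:Z + 1)%R.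
  by rewrite -(ltr_int R) [X in _ < X]intrD bE cE; lra.
lia.
Qed.

Lemma dipoles_cset n y : cset n y -> dipoles n y = 0.
Proof.
move=> yn; rewrite /dipoles big1// => k _.
have yk : band 8 (pow256 k * y) by exact: yn.
by rewrite !indicE !memNset ?subr0// => -[_ [_ /= yb]]; have := band_inj _ _ yk yb => /(_ isT isT).
Qed.

Lemma dipoles_out n y : ~ `[0, 1[%classic y -> dipoles n y = 0.
Proof.
by move=> y01; rewrite /dipoles big1// => k _; rewrite !indicE !memNset ?subr0// => -[].
Qed.

(** Charges of different scales have disjoint supports: those of scale n lie in stage n, where all
    earlier ones vanish. *)
Lemma norm_dipoles n y : `|dipoles n y| <= 1.
Proof.
elim: n => [|n IH]; first by rewrite /dipoles big_ord0 normr0.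
rewrite /dipoles big_ord_recr /= -/(dipoles n y).
have [yn|yn] := pselect (cset n y); last first.
  by rewrite !indicE !memNset ?subr0 ?addr0// => -[_ []].
rewrite dipoles_cset// add0r !indicE.
by case: (_ \in _); case: (_ \in _); rewrite /= ?subrr ?subr0 ?sub0r ?normrN ?normr1 ?normr0.
Qed.

Lemma unit_floor n x y : Num.floor (pow256 n * x) = Num.floor (pow256 n * y) ->
  `[0, 1[%classic x -> `[0, 1[%classic y.
Proof.
move=> xy; have p0 := @pow256_gt0 R n.
have e0 z : (0 <= z) = (0%:~R <= pow256 n * z) by rewrite mulr0z pmulr_rge0.
have e1 z : (z < 1) = ~~ ((256 ^ n)%N%:~R <= pow256 n * z).
  by rewrite -pow256E -ltNge gtr_pMr.
by rewrite /= !in_itv/= (e0 x) (e0 y) !e1 !(le_pow256_floor _ xy).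
Qed.

Lemma part_floor b k n x y : (k < n)%N ->
  Num.floor (pow256 n * x) = Num.floor (pow256 n * y) -> part b k x -> part b k y.
Proof.
move=> kn xy [x01 [xk xb]]; split; first exact: unit_floor xy x01.
split; last exact: band_floor kn xy xb.
by move=> i ik; apply: (band_floor (ltn_trans ik kn) xy); exact: xk.
Qed.

Lemma indic_eq (A B : set R) x y : (A x <-> B y) -> \1_A x = \1_B y :> R.
Proof.
move=> xy; rewrite !indicE; congr ((nat_of_bool _)%:R).
by apply/idP/idP => /set_mem ?; apply/mem_set; apply/xy.
Qed.

Lemma dipoles_floor n x y :
  Num.floor (pow256 n * x) = Num.floor (pow256 n * y) -> dipoles n x = dipoles n y.
Proof.
move=> xy; apply: eq_bigr => k _.
by congr (_ - _); apply: indic_eq; split; apply: part_floor => //; rewrite xy.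
Qed.

Lemma integrable_dipoles n : mu.-integrable [set: R] (EFin \o dipoles n).
Proof.
apply: (le_integrable measurableT _ _ (integrable_indic_itv 0 1 true true)).
  by apply/measurable_EFinP; exact: measurable_dipoles.
move=> y _; rewrite /= lee_fin [leRHS]ger0_norm// indicE.
have [//|y01] := boolP (y \in _); first by move=> _; exact: norm_dipoles.
by rewrite dipoles_out ?normr0// => h; move: y01; rewrite mem_set.
Qed.

(** The factor 1/8 is below the 1/4 of [cset_near]: the ball of this radius around a point of stage
    n + 1 stays in stage n, away from all charges of the scales below n. *)
Definition gap n : R := (pow256 n)^-1 / 8.

Lemma gap_gt0 n : 0 < gap n.
Proof. by rewrite divr_gt0// invr_gt0 pow256_gt0. Qed.

Lemma cset_gap n x y : cset n.+1 x -> `|x - y| <= gap n -> cset n y.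
Proof.
move=> xn xy; apply: cset_near xn _.
rewrite -ltr_pdivlMl ?pow256_gt0// distrC; apply: le_lt_trans xy _.
by rewrite /gap ltr_pM2l ?invr_gt0 ?pow256_gt0//; lra.
Qed.

Lemma part_gap b n k x y : (b < 16)%N -> b != 8 -> (k < n)%N ->
  cset n.+1 x -> part b k y -> gap n < `|x - y|.
Proof.
move=> b16 b8 kn xn [_ [_ /= yb]]; rewrite ltNge; apply/negP => /(cset_gap xn) yn.
by move/eqP: b8; apply; exact: band_inj yb (yn _ kn).
Qed.

(** Band 9 is band 7 moved by 2/16 of a cell. The move stays inside the cell, so the coarser digits
    do not change; it pairs the positive and negative charges into dipoles. *)
Lemma part_translate k y : part 9 k (y + (pow256 k)^-1 / 8) <-> part 7 k y.
Proof.
have p0 := @pow256_gt0 R k.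
pose t : R := (pow256 k)^-1 / 8.
have pt : pow256 k * (y + t) = pow256 k * y + 1 / 8.
  by rewrite /t; field; exact: lt0r_neq0.
have bE : band 9 (pow256 k * (y + t)) <-> band 7 (pow256 k * y).
  by split=> /bandP[m]; rewrite pt => xm; apply/bandP; exists m; rewrite ?pt; lra.
have fE : band 7 (pow256 k * y) -> Num.floor (pow256 k * (y + t)) = Num.floor (pow256 k * y).
  move=> /bandP[m ym]; transitivity m; last symmetry; apply/eqP; rewrite floor_eq intrD ?pt; lra.
split=> -[y01 [yk /= yb]].
  have /fE f := bE.1 yb.
  by split; [exact: unit_floor f y01|split; [exact: cset_floor f yk|exact/bE]].
have /esym f := fE yb.
by split; [exact: unit_floor f y01|split; [exact: cset_floor f yk|exact/bE]].
Qed.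

Lemma integrable_part_cut b k e x : 0 < e ->
  mu.-integrable [set: R] (fun y => (\1_(part b k) y * cut_inv e (x - y))%:E).
Proof.
move=> e0; apply: (@integrable_cut_inv _ (\1_(part b k) : R -> R)) => //.
apply: (le_integrable measurableT _ _ (integrable_indic_itv 0 1 true true)).
  by apply/measurable_EFinP; apply: measurable_indic; exact: measurable_part.
move=> y _; rewrite /= lee_fin !ger0_norm// !indicE.
have [yb|//] := boolP (y \in part b k).
by rewrite mem_set//; have /set_mem[] := yb.
Qed.

End dipoles.

(** * Pointwise field of one dipole *)

Section dipole_integral.
Context {R : realType}.
Local Notation mu := (@lebesgue_measure R).
Implicit Types (e eta s x y z : R) (k m n b : nat).

Lemma integrable_pkernel q u v : 1 < q -> 0 < v ->
  mu.-integrable [set: R] (EFin \o pkernel q 0 u v).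
Proof.
move=> q1 v0; apply/integrableP; split.
  by apply/measurable_EFinP; exact: measurable_pkernel.
under eq_integral do rewrite /= ger0_norm ?pkernel_ge0//.
by rewrite integral_pkernel// ltry.
Qed.

(* In units of [256^-k]: the field of a unit dipole of width [1/8] at distance
   [s], whose near side is closer than [1/8] (first case) or which lies in
   another cell (last two cases). *)
Lemma dipole_near (s : R) : 0 < s -> s < 1 / 8 -> 32 <= s^-1 - (s - 1 / 8)^-1.
Proof.
move=> s0 s8; have r0 : 0 < 1 / 8 - s by rewrite subr_gt0.
have -> : s^-1 - (s - 1 / 8)^-1 = (1 / 8) / (s * (1 / 8 - s)).
  by field; do ?[apply/andP; split]; apply/eqP => h; lra.
rewrite ler_pdivlMr ?mulr_gt0//.
by have := sqr_ge0 (s - 1 / 16); nra.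
Qed.

Lemma dipole_far_left (s : R) : 1 < s ->
  - (2 / 3) * ((1 + s) ^+ 2)^-1 <= s^-1 - (s - 1 / 8)^-1.
Proof.
move=> s1; have r0 : 0 < s - 1 / 8 by lra.
have s0 : 0 < s by lra.
have -> : s^-1 - (s - 1 / 8)^-1 = - (1 / 8 / (s * (s - 1 / 8))).
  by field; do ?[apply/andP; split]; apply/eqP => h; lra.
rewrite mulNr lerN2 ler_pdivrMr ?mulr_gt0// -mulrAC ler_pdivlMr ?exprn_gt0//; last by lra.
nra.
Qed.

Lemma dipole_far_right (r : R) : 7 / 8 < r ->
  - (2 / 3) * ((1 + r) ^+ 2)^-1 <= (- r)^-1 - (- r - 1 / 8)^-1.
Proof.
move=> r1; have r0 : 0 < r by lra.
have r2 : 0 < r + 1 / 8 by lra.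
have -> : (- r)^-1 - (- r - 1 / 8)^-1 = - (1 / 8 / (r * (r + 1 / 8))).
  by rewrite -opprD !invrN; field; do ?[apply/andP; split]; apply/eqP => h; lra.
rewrite mulNr lerN2 ler_pdivrMr ?mulr_gt0// -mulrAC ler_pdivlMr ?exprn_gt0//; last by lra.
nra.
Qed.

Lemma pkernel2E k x y : pkernel 2 0 x (pow256 k)^-1 y =
  pow256 k * ((1 + `|pow256 k * (x - y)|) ^+ 2)^-1.
Proof.
have p0 := @pow256_gt0 R k.
rewrite pkernel0E invrK normrM gtr0_norm// distrC [`|_| * _]mulrC.
by rewrite powR_invn// addr_ge0// mulr_ge0// ltW.
Qed.

(** Band 7 of the scale-k cell that contains x; for x in the middle band it is the adjacent positive
    charge. *)
Definition near_part k x : set R :=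
  `[(Num.floor (pow256 k * x))%:~R / pow256 k + 7 / 16 / pow256 k,
    (Num.floor (pow256 k * x))%:~R / pow256 k + 1 / 2 / pow256 k[.

Lemma near_partP k x y : near_part k x y <->
  (Num.floor (pow256 k * x))%:~R + 7 / 16 <= pow256 k * y <
  (Num.floor (pow256 k * x))%:~R + 1 / 2.
Proof.
have p0 := @pow256_gt0 R k.
rewrite /near_part /= in_itv/= -!mulrDl ler_pdivrMr// ltr_pdivlMr//.
by rewrite [y * _]mulrC.
Qed.

Lemma lebesgue_measure_near_part k x :
  mu (near_part k x) = (1 / 16 / pow256 k)%:E.
Proof.
have p0 := @pow256_gt0 R k.
rewrite /near_part lebesgue_measure_itv/= lte_fin ltrD2l ltr_pM2r ?invr_gt0//.
rewrite ifT; last by lra.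
by rewrite -EFinB; congr EFin; field; exact: lt0r_neq0.
Qed.

Lemma near_part_sub k n x y : (k < n)%N -> cset n x -> `[0, 1[%classic x ->
  near_part k x y -> part 7 k y.
Proof.
move=> kn xn x01 /near_partP; move: (floor_itv (pow256 k * x)) => xm.
set m := Num.floor (pow256 k * x) in xm * => ym.
have f : Num.floor (pow256 k * x) = Num.floor (pow256 k * y).
  by rewrite -/m; apply/esym/eqP; rewrite floor_eq intrD; lra.
split; first exact: unit_floor f x01.
split; first by apply: cset_floor f _; exact: cset_sub (ltnW kn) _ xn.
by apply/bandP; exists m; lra.
Qed.

(** Both charges of a dipole are farther than [gap n] from x, so the truncation is inactive. The
    dipole in the cell of x lies on both sides of x and its two contributions add up; dipoles in
    other cells nearly cancel, and their loss is dominated by an integrable kernel. *)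
Lemma dipole_pointwise k n x y : (k < n)%N -> cset n.+1 x -> `[0, 1[%classic x ->
  pow256 k * (32 * \1_(near_part k x) y) - 2 / 3 * pkernel 2 0 x (pow256 k)^-1 y <=
  \1_(part 7 k) y *
    (cut_inv (gap n) (x - y) - cut_inv (gap n) (x - (y + (pow256 k)^-1 / 8))).
Proof.
move=> kn xn x01; have p0 := @pow256_gt0 R k.
have pk0 : 0 <= 2 / 3 * pkernel 2 0 x (pow256 k)^-1 y.
  by rewrite mulr_ge0 ?pkernel_ge0 ?invr_gt0// divr_ge0.
have xn' : cset n x by exact: cset_sub xn.
have [y7|y7] := pselect (part 7 k y); last first.
  rewrite [in leRHS]indicE memNset// mul0r indicE memNset ?mulr0 ?sub0r ?oppr_le0//.
  by move/(near_part_sub kn xn' x01).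
have g7 := @part_gap R 7 n k x y isT isT kn xn y7.
have g9 := @part_gap R 9 n k x _ isT isT kn xn ((part_translate k y).2 y7).
rewrite [in leRHS]indicE mem_set// mul1r /cut_inv g7 g9 pkernel2E.
have xy0 : pow256 k * (x - y) = pow256 k * x - pow256 k * y by rewrite mulrBr.
pose s := pow256 k * (x - y).
have -> : (x - y)^-1 - (x - (y + (pow256 k)^-1 / 8))^-1 =
    pow256 k * (s^-1 - (s - 1 / 8)^-1).
  have -> : s - 1 / 8 = pow256 k * (x - (y + (pow256 k)^-1 / 8)).
    by rewrite /s; field; exact: lt0r_neq0.
  by rewrite /s !invfM mulrBr !mulVKf ?pow256_neq0.
rewrite [2 / 3 * _]mulrCA -mulrBr ler_pM2l// -/s.
have [_ [_ /bandP[m' ym]]] := y7.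
have /bandP[m xm] : band 8 (pow256 k * x) by exact: (xn' _ kn).
have mE : Num.floor (pow256 k * x) = m by apply/eqP; rewrite floor_eq intrD; lra.
have nE : near_part k x y <-> m = m'.
  rewrite near_partP mE; split => [h|->]; last by lra.
  have : (m < m' + 1)%R by rewrite -(ltr_int R) intrD; lra.
  have : (m' < m + 1)%R by rewrite -(ltr_int R) intrD; lra.
  lia.
have [mm|mm|mm] := ltgtP m m'.
- have mm1 : m%:~R + 1 <= m'%:~R :> R by rewrite -[1]/(1%:~R) -intrD ler_int; lia.
  rewrite indicE memNset ?mulr0 ?sub0r; last by move/nE; lia.
  (* The charge lies to the right in another cell: 1 + 7/16 - 9/16 = 7/8. *)
  have r1 : 7 / 8 < - s by rewrite /s xy0; lra.
  have := dipole_far_right r1; rewrite opprK mulNr.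
  by rewrite [`|s|]ltr0_norm//; lra.
- have mm1 : m'%:~R + 1 <= m%:~R :> R by rewrite -[1]/(1%:~R) -intrD ler_int; lia.
  rewrite indicE memNset ?mulr0 ?sub0r; last by move/nE; lia.
  (* The charge lies to the left in another cell: 1 + 8/16 - 8/16 = 1. *)
  have r1 : 1 < s by rewrite /s xy0; lra.
  have := dipole_far_left r1; rewrite mulNr.
  by rewrite [`|s|]gtr0_norm//; lra.
- rewrite indicE mem_set; last exact/nE.
  have s0 : 0 < s by rewrite /s xy0; move: xm ym; rewrite mm; lra.
  have s1 : s < 1 / 8 by rewrite /s xy0; move: xm ym; rewrite mm; lra.
  rewrite mulr1; have := dipole_near s0 s1.
  have : 0 <= 2 / 3 * ((1 + `|s|) ^+ 2)^-1.
    by rewrite mulr_ge0 ?invr_ge0 ?exprn_ge0// ?addr_ge0// divr_ge0.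
  lra.
Qed.

End dipole_integral.

(** * Total field of the dipoles *)

Section dipole_field.
Context {R : realType}.
Local Notation mu := (@lebesgue_measure R).
Implicit Types (e eta s x y z : R) (k m n b : nat).

Lemma Rintegral_shift (f : R -> R) t : mu.-integrable [set: R] (EFin \o f) ->
  \int[mu]_y f (y + t) = \int[mu]_y f y.
Proof.
move=> intf; have := integral_affine t (@oner_neq0 R) intf.
rewrite normr1 invr1 mul1e /Rintegral => <-.
by congr fine; apply: eq_integral => y _ /=; rewrite mul1r.
Qed.

Lemma integrable_shift (f : R -> R) t : mu.-integrable [set: R] (EFin \o f) ->
  mu.-integrable [set: R] (fun y => (f (y + t))%:E).
Proof.
move=> intf; apply: (@eq_integrable _ _ _ mu _ measurableT
  (fun y => (EFin \o f) (1 * y + t))) => //.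
  by move=> y _; rewrite /= mul1r.
exact: (integrable_affine t (@oner_neq0 R) intf).
Qed.

Lemma Rintegral_near_part k x : \int[mu]_y \1_(near_part k x) y = 1 / 16 / pow256 k.
Proof.
rewrite /Rintegral integral_indic//; last exact: measurable_itv.
by rewrite setIT [X in fine X]lebesgue_measure_near_part.
Qed.

Lemma integrable_near_part k x :
  mu.-integrable [set: R] (EFin \o (\1_(near_part k x) : R -> R)).
Proof. exact: integrable_indic_itv. Qed.

Lemma Rintegral_pkernel q u v : 1 < q -> 0 < v ->
  \int[mu]_y pkernel q 0 u v y = 2 / (q - 1).
Proof. by move=> q1 v0; rewrite /Rintegral integral_pkernel. Qed.

(** After band 9 has been moved onto band 7, the pointwise bound integrates to a gain of 32 * 1/16 =
    2 from the cell of x minus a loss of 2/3 * 2 = 4/3 from all others, independently of the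
    scale. *)
Lemma integral_dipole_ge k n x : (k < n)%N -> cset n.+1 x -> `[0, 1[%classic x ->
  2 / 3 <= \int[mu]_y ((\1_(part 7 k) y - \1_(part 9 k) y) * cut_inv (gap n) (x - y)).
Proof.
move=> kn xn x01; have p0 := @pow256_gt0 R k; have g0 := @gap_gt0 R n.
have i7 := integrable_part_cut 7 k x g0.
have i9 := integrable_part_cut 9 k x g0.
pose t : R := (pow256 k)^-1 / 8.
pose f9 y : R := \1_(part 9 k) y * cut_inv (gap n) (x - y).
have s9 y : f9 (y + t) = \1_(part 7 k) y * cut_inv (gap n) (x - (y + t)).
  by congr (_ * _); apply: indic_eq; exact: part_translate.
have i9t : mu.-integrable [set: R]
    (fun y => (\1_(part 7 k) y * cut_inv (gap n) (x - (y + t)))%:E).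
  apply: (@eq_integrable _ _ _ mu _ measurableT (fun y => (f9 (y + t))%:E)) => //.
    by move=> y _; rewrite s9.
  exact: integrable_shift.
have -> : \int[mu]_y ((\1_(part 7 k) y - \1_(part 9 k) y) * cut_inv (gap n) (x - y)) =
    \int[mu]_y (\1_(part 7 k) y *
      (cut_inv (gap n) (x - y) - cut_inv (gap n) (x - (y + t)))).
  transitivity (\int[mu]_y (\1_(part 7 k) y * cut_inv (gap n) (x - y)) - \int[mu]_y f9 y).
    rewrite -RintegralB//; apply: eq_Rintegral => y _; exact: mulrBl.
  rewrite -(@Rintegral_shift f9 t)//.
  transitivity (\int[mu]_y (\1_(part 7 k) y * cut_inv (gap n) (x - y)) -
     \int[mu]_y (\1_(part 7 k) y * cut_inv (gap n) (x - (y + t)))).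
    by congr (_ - _); apply: eq_Rintegral => y _; exact: s9.
  by rewrite -RintegralB//; apply: eq_Rintegral => y _; rewrite mulrBr.
have h0 : 0 < (pow256 k)^-1 :> R by rewrite invr_gt0.
have q2 : 1 < 2 :> R by rewrite ltr1n.
have ik := integrable_pkernel x q2 h0.
have ik' : mu.-integrable [set: R] (fun y => (2 / 3 * pkernel 2 0 x (pow256 k)^-1 y)%:E).
  exact: (@integrableZl _ _ _ mu _ measurableT (2 / 3) _ ik).
have ia : mu.-integrable [set: R] (fun y => (32 * \1_(near_part k x) y)%:E).
  exact: (@integrableZl _ _ _ mu _ measurableT 32 _ (integrable_near_part k x)).
have ia' : mu.-integrable [set: R] (fun y => (pow256 k * (32 * \1_(near_part k x) y))%:E).
  exact: (@integrableZl _ _ _ mu _ measurableT (pow256 k) _ ia).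
have -> : 2 / 3 = \int[mu]_y (pow256 k * (32 * \1_(near_part k x) y) -
    2 / 3 * pkernel 2 0 x (pow256 k)^-1 y) :> R.
  rewrite RintegralB// (@RintegralZl _ _ _ mu setT _ (2 / 3) measurableT ik).
  rewrite Rintegral_pkernel// !RintegralZl//; last exact: integrable_near_part.
  rewrite Rintegral_near_part.
  by field; exact: lt0r_neq0.
apply: le_Rintegral => //.
- exact: (integrableB measurableT ia' ik').
- apply: (@eq_integrable _ _ _ mu _ measurableT
    ((fun y => (\1_(part 7 k) y * cut_inv (gap n) (x - y))%:E) \-
     (fun y => (\1_(part 7 k) y * cut_inv (gap n) (x - (y + t)))%:E))%E) => //.
    by move=> y _; rewrite /= -EFinB mulrBr.
  exact: (integrableB measurableT i7 i9t).
- by move=> y _; exact: dipole_pointwise.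
Qed.

Lemma integral_dipoles_ge n x : cset n.+1 x -> `[0, 1[%classic x ->
  n%:R * (2 / 3) <= \int[mu]_y (dipoles n y * cut_inv (gap n) (x - y)).
Proof.
move=> xn x01; have g0 := @gap_gt0 R n.
(* The truncation radius stays at [gap n] while the number of scales grows. *)
suff H m : (m <= n)%N ->
  m%:R * (2 / 3) <= \int[mu]_y (dipoles m y * cut_inv (gap n) (x - y)) by exact: H.
elim: m => [_|m IH mn].
  by rewrite mul0r Rintegral_ge0// => y _; rewrite /dipoles big_ord0 mul0r.
have im : mu.-integrable [set: R] (fun y =>
    ((\1_(part 7 m) y - \1_(part 9 m) y) * cut_inv (gap n) (x - y))%:E).
  apply: (@eq_integrable _ _ _ mu _ measurableT
    ((fun y => (\1_(part 7 m) y * cut_inv (gap n) (x - y))%:E) \-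
     (fun y => (\1_(part 9 m) y * cut_inv (gap n) (x - y))%:E))%E) => //.
    by move=> y _; rewrite /= -EFinB mulrBl.
  by apply: (integrableB measurableT); exact: integrable_part_cut.
have -> : \int[mu]_y (dipoles m.+1 y * cut_inv (gap n) (x - y)) =
    \int[mu]_y (dipoles m y * cut_inv (gap n) (x - y)) +
    \int[mu]_y ((\1_(part 7 m) y - \1_(part 9 m) y) * cut_inv (gap n) (x - y)).
  rewrite -RintegralD//; last exact: integrable_cut_inv (integrable_dipoles m).
  by apply: eq_Rintegral => y _; rewrite /dipoles big_ord_recr/= mulrDl.
by rewrite -natr1 mulrDl mul1r lerD// ?IH ?integral_dipole_ge// ltnW.
Qed.

End dipole_field.

(** * Lower bounds for the operator norm *)

Section bilinear.
Context {R : realType}.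
Local Notation mu := (@lebesgue_measure R).
Implicit Types (f g : R -> R) (e x y : R).

Definition cut_hilbert e g x : R := \int[mu]_y (g y * cut_inv e (x - y)).

Definition pair_kernel e f g (z : R * R) : \bar R :=
  (f z.1 * (g z.2 * cut_inv e (z.1 - z.2)))%:E.

Lemma integrable_pair_kernel e f g : 0 < e ->
  mu.-integrable [set: R] (EFin \o f) -> mu.-integrable [set: R] (EFin \o g) ->
  (mu \x mu)%E.-integrable [set: R * R] (pair_kernel e f g).
Proof.
move=> e0 intf intg.
have /measurable_EFinP mf := measurable_int _ intf.
have /measurable_EFinP mg := measurable_int _ intg.
have mH : measurable_fun [set: R * R] (pair_kernel e f g).
  apply/measurable_EFinP; apply: measurable_funM.
    by apply: (measurableT_comp mf); exact: measurable_fst.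
  apply: measurable_funM; first by apply: (measurableT_comp mg); exact: measurable_snd.
  apply: (measurableT_comp (measurable_cut_inv e)); apply: measurable_funB.
    exact: measurable_fst.
  exact: measurable_snd.
apply/integrableP; split => //.
rewrite fubini_tonelli1//; last exact: measurableT_comp.
have /integrableP[_ foo] := intf; have /integrableP[_ goo] := intg.
pose B := (\int[mu]_y `|(g y)%:E|)%E.
apply: (@le_lt_trans _ _ (\int[mu]_x (`|(f x)%:E| * (e^-1%:E * B)))%E).
  apply: ge0_le_integral_any => x; first exact: integral_ge0.
  have mfg : measurable_fun [set: R] (fun y => `|(g y)%:E|%E).
    by apply: measurableT_comp => //; exact/measurable_EFinP.
  rewrite /B -ge0_integralZl ?lee_fin ?invr_ge0 ?(ltW e0)//.
  rewrite -ge0_integralZl//; last 2 first.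
  - exact: measurable_funeM.
  - by move=> y _; rewrite mule_ge0// lee_fin invr_ge0 ltW.
  apply: ge0_le_integral_any => y //.
  rewrite /pair_kernel /= !normrM -!EFinM lee_fin.
  rewrite ler_wpM2l// mulrC ler_wpM2r//.
  exact: norm_cut_inv.
have B0 : (0 <= B)%E by exact: integral_ge0.
have eB0 : (0 <= e^-1%:E * B)%E by rewrite mule_ge0// lee_fin invr_ge0 ltW.
rewrite ge0_integralZr//; last by apply: measurableT_comp => //; exact/measurable_EFinP.
have Bfin : B \is a fin_num by rewrite ge0_fin_numE.
rewrite -(fineK Bfin) -EFinM lte_mul_pinfty//; first exact: integral_ge0.
rewrite ge0_fin_numE//; exact: integral_ge0.
exact: ltry.
Qed.

Lemma integral_pair_kernel e f g x : 0 < e -> mu.-integrable [set: R] (EFin \o g) ->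
  (\int[mu]_y pair_kernel e f g (x, y) = (f x * cut_hilbert e g x)%:E)%E.
Proof.
move=> e0 intg; have ig := integrable_cut_inv x e0 intg.
rewrite /pair_kernel /cut_hilbert /Rintegral EFinM fineK; last exact: integrable_fin_num.
by rewrite -integralZl.
Qed.

Lemma integrable_mul_cut_hilbert e f g : 0 < e ->
  mu.-integrable [set: R] (EFin \o f) -> mu.-integrable [set: R] (EFin \o g) ->
  mu.-integrable [set: R] (fun x => (f x * cut_hilbert e g x)%:E).
Proof.
move=> e0 intf intg.
apply: (@eq_integrable _ _ _ mu _ measurableT (fubini_F mu (pair_kernel e f g))) => //.
  by move=> x _; rewrite /fubini_F integral_pair_kernel.
exact: (integrable_fubini_F (integrable_pair_kernel e0 intf intg)).
Qed.

(** Fubini's theorem and the oddness of the kernel. The dual estimate thereby reuses the lower bound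
    for the field of the dipoles. *)
Lemma cut_hilbert_swap e f g : 0 < e ->
  mu.-integrable [set: R] (EFin \o f) -> mu.-integrable [set: R] (EFin \o g) ->
  (\int[mu]_x (f x * cut_hilbert e g x)%:E =
   - \int[mu]_y (g y * cut_hilbert e f y)%:E)%E.
Proof.
move=> e0 intf intg.
transitivity (\int[mu]_x \int[mu]_y pair_kernel e f g (x, y))%E.
  by apply: eq_integral => x _; rewrite integral_pair_kernel.
rewrite (Fubini (integrable_pair_kernel e0 intf intg)).
rewrite -integralN; last first.
  apply: fin_num_adde_defr; apply: integrable_pos_fin_num => //.
  exact: integrable_mul_cut_hilbert.
apply: eq_integral => y _; rewrite -integral_pair_kernel//.
rewrite -integralN; last first.
  apply: fin_num_adde_defr; apply: integrable_pos_fin_num => //.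
  have := integrable_cut_inv y e0 intf => /(integrableZl measurableT (g y)).
  by [].
apply: eq_integral => x _; rewrite /pair_kernel /=; congr EFin.
by rewrite -opprB cut_invN; ring.
Qed.

End bilinear.

(** * Testing the first family *)

Section norm_lower_bounds.
Context {R : realType}.
Local Notation mu := (@lebesgue_measure R).
Implicit Types (f w : R -> R) (p x y : R) (n N : nat).

Lemma hilbert_norm_ge p w f (a : R) : 0 < p -> 0 <= a ->
  measurable_fun [set: R] f -> {ae mu, forall x, has_hilbert f x} ->
  (\int[mu]_x (`|f x| `^ p * w x)%:E <= 1)%E ->
  (0 <= \int[mu]_x (`|f x| `^ p * w x)%:E)%E ->
  ((a `^ p)%:E <= \int[mu]_x (`|hilbert f x| `^ p * w x)%:E)%E ->
  (a%:E <= hilbert_norm p w)%E.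
Proof.
move=> p0 a0 mf hf f1 f0 fa.
have ip : 0 <= p^-1 by rewrite invr_ge0 ltW.
apply: (@le_trans _ _ (Lpw_norm p w (hilbert f))); last first.
  apply: ereal_sup_ubound; exists f => //; split => //.
  rewrite -(poweR1r p^-1); apply: gt0_ler_poweR => //.
    by rewrite in_itv/= leey andbT.
  by rewrite in_itv/= leey andbT.
have -> : a%:E = ((a `^ p)%:E `^ p^-1)%E.
  by rewrite poweR_EFin -powRrM mulfV ?gt_eqF// powRr1.
apply: gt0_ler_poweR => //.
  by rewrite in_itv/= leey andbT lee_fin powR_ge0.
by rewrite in_itv/= leey andbT (le_trans _ fa)// lee_fin powR_ge0.
Qed.

Definition unit_cset N : set R := cset N `&` `[0, 1[%classic.

Lemma measurable_unit_cset N : measurable (unit_cset N).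
Proof. by apply: measurableI => //; exact: measurable_cset. Qed.

Lemma integral_unit_cset N : (\int[mu]_x (\1_(unit_cset N) x)%:E = (16^-1 ^+ N)%:E)%E.
Proof.
rewrite integral_indic//; last exact: measurable_unit_cset.
by rewrite setIT -lebesgue_measure_cset.
Qed.

Lemma integrable_unit_cset N : mu.-integrable [set: R] (EFin \o (\1_(unit_cset N) : R -> R)).
Proof.
apply/integrableP; split.
  by apply/measurable_EFinP; apply: measurable_indic; exact: measurable_unit_cset.
under eq_integral do rewrite /= ger0_norm//.
by rewrite integral_unit_cset ltry.
Qed.

Lemma integrableZ (c : R) f : mu.-integrable [set: R] (EFin \o f) ->
  mu.-integrable [set: R] (EFin \o (fun x => c * f x)).
Proof. by move=> intf; exact: (@integrableZl _ _ _ mu _ measurableT c _ intf). Qed.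

Lemma cut_hilbertZ e c f x : 0 < e -> mu.-integrable [set: R] (EFin \o f) ->
  cut_hilbert e (fun y => c * f y) x = c * cut_hilbert e f x.
Proof.
move=> e0 intf; rewrite /cut_hilbert -RintegralZl//; last exact: integrable_cut_inv.
by apply: eq_Rintegral => y _; rewrite mulrA.
Qed.

Lemma norm_dipoles_le n y : `|dipoles n y| <= \1_`[0, 1[%classic y :> R.
Proof.
rewrite indicE; have [_|y01] := boolP (y \in _); first exact: norm_dipoles.
by rewrite dipoles_out ?normr0// => h; move: y01; rewrite mem_set.
Qed.

Lemma hilbert_norm_cweight p n : 1 < p ->
  ((n%:R * (1 / 3))%:E <= hilbert_norm p (cweight n.+1))%E.
Proof.
move=> p1; have p0 : 0 < p by lra.
(* One stage more than the n scales of dipoles, so that points of the last stage keep the distance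
   [gap n] from all charges. *)
set N := n.+1; have N0 : 0 < N%:R *+ 2 :> R by rewrite pmulrn_rgt0// ltr0n.
have w0 x : 0 <= cweight N x by rewrite ltW// cweight_gt0.
(* Since the dipoles are at most 1 and vanish off [0, 1), where the weight has mass 2N, this
   normalizes the test function. *)
pose c : R := (N%:R *+ 2) `^ (- p^-1).
have c0 : 0 <= c by exact: powR_ge0.
have cp : c `^ p = (N%:R *+ 2)^-1.
  by rewrite /c -powRrM mulNr mulVf ?gt_eqF// powR_inv1// ltW.
have g0 := @gap_gt0 R n.
have id := @integrable_dipoles R n.
have idc := integrableZ c id.
apply: (@hilbert_norm_ge _ _ (fun y => c * dipoles n y)) => //.
- by apply: measurable_funM => //; exact: measurable_dipoles.
- apply: (@has_hilbert_grid _ _ n) => // x y xy; congr (_ * _); exact: dipoles_floor.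
- apply: (@le_trans _ _ (\int[mu]_x ((c `^ p)%:E * (cweight N x * \1_`[0, 1[%classic x)%:E))%E).
    apply: ge0_le_integral_any => x; first by rewrite lee_fin mulr_ge0 ?powR_ge0.
    rewrite -EFinM lee_fin [cweight N x * _]mulrC mulrA ler_wpM2r//.
    rewrite normrM (ger0_norm c0) powRM// ler_wpM2l ?powR_ge0//.
    apply: (@le_trans _ _ (\1_`[0, 1[%classic x `^ p)).
      by rewrite ge0_ler_powR ?nnegrE ?(ltW p0)// norm_dipoles_le.
    by rewrite indicE; case: (_ \in _); rewrite /= ?powR1 ?powR0 ?gt_eqF.
  rewrite ge0_integralZl ?lee_fin ?powR_ge0//; last 2 first.
  + apply/measurable_EFinP; apply: measurable_funM; first exact: measurable_cweight.
    exact: measurable_indic.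
  + by move=> x _; rewrite lee_fin mulr_ge0.
  by rewrite integral_cweight_unit cp -EFinM mulVf// gt_eqF.
- by apply: integral_ge0 => x _; rewrite lee_fin mulr_ge0 ?powR_ge0.
have hx x : unit_cset N x -> c * (n%:R * (2 / 3)) <= hilbert (fun y => c * dipoles n y) x.
  move=> [xN x01].
  have [_ ->] : has_hilbert (fun y => c * dipoles n y) x /\
      hilbert (fun y => c * dipoles n y) x = cut_hilbert (gap n) (fun y => c * dipoles n y) x.
    apply: hilbert_loc_const => // y /(cset_gap xN) yn.
    by rewrite !dipoles_cset//; exact: cset_sub xN.
  by rewrite cut_hilbertZ// ler_wpM2l// integral_dipoles_ge.
(* Only the last stage is kept: there the weight is at least N 16^N on a set of measure 16^-N, which
   is half of the total mass 2N. *)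
apply: (@le_trans _ _ (\int[mu]_x (((c * (n%:R * (2 / 3))) `^ p * (N%:R * 16 ^+ N))%:E *
    (\1_(unit_cset N) x)%:E))%E); last first.
  have k0 : 0 <= (c * (n%:R * (2 / 3))) `^ p * (N%:R * 16 ^+ N).
    by rewrite mulr_ge0 ?powR_ge0// mulr_ge0// exprn_ge0.
  apply: ge0_le_integral_any => x; first by rewrite -EFinM lee_fin mulr_ge0.
  rewrite -EFinM lee_fin indicE.
  have [/set_mem xA|_] := boolP (x \in unit_cset N); last first.
    by rewrite mulr0 mulr_ge0 ?powR_ge0.
  have a0 : 0 <= c * (n%:R * (2 / 3)) by rewrite !mulr_ge0// divr_ge0.
  rewrite mulr1 ler_pM ?powR_ge0 ?mulr_ge0 ?exprn_ge0//.
    rewrite ge0_ler_powR ?nnegrE ?(ltW p0)//.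
    by apply: le_trans (hx _ xA) _; exact: ler_norm.
  by apply: cweight_on => //; case: xA.
rewrite ge0_integralZl//; last 2 first.
- by apply/measurable_EFinP; apply: measurable_indic; exact: measurable_unit_cset.
- by rewrite lee_fin mulr_ge0 ?powR_ge0// mulr_ge0// exprn_ge0.
rewrite integral_unit_cset -EFinM lee_fin.
have n23 : 0 <= n%:R * (2 / 3) :> R by rewrite mulr_ge0// divr_ge0.
(* The factor 1/2 is set apart to be compared with the mass ratio N / (2N), through 2^-p <= 2^-1. *)
have -> : n%:R * (1 / 3) = n%:R * (2 / 3) * 2^-1 :> R by field.
have e16 : 16 ^+ N * 16^-1 ^+ N = 1 :> R by rewrite -exprMn divff ?expr1n.
move: (n%:R * (2 / 3)) n23 {hx} => X X0.
rewrite powRM// powRM// cp.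
have -> : (N%:R *+ 2)^-1 * X `^ p * (N%:R * 16 ^+ N) * 16^-1 ^+ N =
    X `^ p * ((N%:R *+ 2)^-1 * N%:R) * (16 ^+ N * 16^-1 ^+ N) by ring.
rewrite e16 mulr1 ler_wpM2l ?powR_ge0//.
have -> : (N%:R *+ 2)^-1 * N%:R = 2^-1 :> R.
  by rewrite -mulr_natl; field; rewrite pnatr_eq0.
rewrite -powR_inv1// -powRrM mulN1r powRN powR_inv1// lef_pV2 ?posrE ?powR_gt0//.
by have := ler_powR (ler1n R 2) (ltW p1); rewrite powRr1.
Qed.

End norm_lower_bounds.

(** * Testing the dual family *)

Section dual_lower_bound.
Context {R : realType}.
Local Notation mu := (@lebesgue_measure R).
Implicit Types (f w : R -> R) (p x y : R) (n N : nat).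

Lemma unit_cset_floor N x y : Num.floor (pow256 N * x) = Num.floor (pow256 N * y) ->
  unit_cset N x -> unit_cset N y.
Proof. by move=> xy [xN x01]; split; [exact: cset_floor xy xN|exact: unit_floor xy x01]. Qed.

(* Young's inequality for [g = (g / s) * s] with [s^p' = t w]. *)
Lemma weighted_young p (t g w : R) : 1 < p -> 0 < t -> 0 <= g -> 0 < w ->
  g <= t `^ (- (p - 1)) / p * (g `^ p * w `^ (- (p - 1))) + t * w.
Proof.
move=> p1 t0 g0 w0; have p0 : 0 < p by lra.
have p10 : 0 < p - 1 by rewrite subr_gt0.
pose q := p / (p - 1); have q1 : 1 < q by exact: conjugate_gt1.
have q0 : 0 < q by lra.
have pq : p^-1 + q^-1 = 1 by rewrite /q; field; rewrite !gt_eqF.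
pose s := (t * w) `^ q^-1.
have s0 : 0 < s by rewrite powR_gt0// mulr_gt0.
have := @conjugate_powR R (g / s) s p q _ (ltW s0) p0 q0 pq.
rewrite divr_ge0 ?(ltW s0)// divfK ?gt_eqF// => /(_ isT) /le_trans; apply.
have sq : s `^ q = t * w.
  by rewrite /s -powRrM mulVf ?gt_eqF// powRr1// mulr_ge0 ?ltW.
rewrite sq lerD//; last first.
  by rewrite ler_pdivrMr// ler_peMr ?(ltW q1)// mulr_ge0 ?ltW.
rewrite powRM ?invr_ge0 ?(ltW s0)// -(powR_inv1 (ltW s0)) -powRrM mulN1r.
have -> : s `^ (- p) = t `^ (- (p - 1)) * w `^ (- (p - 1)).
  rewrite /s -powRrM (_ : q^-1 * - p = - (p - 1)); last first.
    by rewrite /q; field; rewrite !gt_eqF.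
  by rewrite powRM ?ltW.
by rewrite le_eqVlt; apply/orP; left; apply/eqP; ring.
Qed.

Lemma ereal_half_le (a g : R) (H : \bar R) : 0 < a -> (0 <= H)%E ->
  (g%:E <= a%:E * H + (g / 2)%:E)%E -> ((g / 2 / a)%:E <= H)%E.
Proof.
move=> a0; case: H => [r _|_ _|//]; last by rewrite leey.
by rewrite -EFinM -EFinD !lee_fin ler_pdivrMr// => h; lra.
Qed.

(** The transform of the normalized indicator of E_N is paired with the dipoles: antisymmetry bounds
    the pairing from below, and Young's inequality bounds it from above by the weighted norm plus a
    multiple of the mass 2N, which is made half of the lower bound and absorbed. *)
Lemma hilbert_norm_dual p n : 1 < p -> (0 < n)%N ->
  ((n%:R * (1 / 6))%:E <= hilbert_norm p (dual_cweight p n.+1))%E.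
Proof.
move=> p1 n0; have p0 : 0 < p by lra.
have p10 : 0 < p - 1 by rewrite subr_gt0.
set N := n.+1; pose v : R := N%:R; have v0 : 0 < v by rewrite ltr0n.
pose m : R := 16 ^+ N; have m0 : 0 < m by rewrite exprn_gt0.
have w0 x : 0 < cweight N x :> R by exact: cweight_gt0.
have d0 x : 0 <= dual_cweight p N x by exact: powR_ge0.
(* With c = m k the function F has norm at most 1: c^p contributes N^(p-1) m^p, the dual weight on
   E_N at most (N m)^(1-p), and the measure of E_N is 1/m. *)
pose k : R := v `^ ((p - 1) / p).
have k0 : 0 < k by rewrite powR_gt0.
have kp : k `^ p = v `^ (p - 1) by rewrite /k -powRrM divfK// gt_eqF.
pose c : R := m * k; have c0 : 0 < c by rewrite mulr_gt0.
pose F y : R := c * \1_(unit_cset N) y.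
have g0 := @gap_gt0 R n.
have iF : mu.-integrable [set: R] (EFin \o F).
  by apply: integrableZ; exact: integrable_unit_cset.
have id := @integrable_dipoles R n.
(* Where the dipoles do not vanish, x lies outside stage n and E_N is farther than [gap n], so the
   truncated transform of F is the true one; as the dipoles are at most 1, |U| <= |HF|
   everywhere. *)
pose U x : R := dipoles n x * cut_hilbert (gap n) F x.
have iU : mu.-integrable [set: R] (EFin \o U) by exact: integrable_mul_cut_hilbert.
have /measurable_EFinP mU := measurable_int _ iU.
have UH x : `|U x| <= `|hilbert F x|.
  have [d|d] := eqVneq (dipoles n x) 0; first by rewrite /U d mul0r normr0.
  have F0 y : `|x - y| <= gap n -> F y = 0.
    move=> xy; rewrite /F indicE memNset ?mulr0// => -[yN _].
    by move/eqP: d; apply; apply: dipoles_cset; apply: cset_gap yN _; rewrite distrC.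
  have [_ ->] : has_hilbert F x /\ hilbert F x = cut_hilbert (gap n) F x.
    apply: hilbert_loc_const => // y /F0 ->.
    by rewrite F0// subrr normr0 ltW.
  by rewrite normrM ler_piMl// norm_dipoles.
pose G : R := n%:R * (2 / 3) * k.
have G0 : 0 < G by rewrite !mulr_gt0 ?divr_gt0 ?ltr0n.
have GU : (G%:E <= \int[mu]_x `|(U x)%:E|)%E.
  have -> : G%:E = (\int[mu]_y ((c * (n%:R * (2 / 3)))%:E * (\1_(unit_cset N) y)%:E))%E.
    have cn0 : 0 <= c * (n%:R * (2 / 3)) by rewrite ltW// !mulr_gt0 ?divr_gt0 ?ltr0n.
    rewrite ge0_integralZl//; last first.
      by apply/measurable_EFinP; apply: measurable_indic; exact: measurable_unit_cset.
    rewrite integral_unit_cset -EFinM /G /c /m; congr EFin.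
    rewrite exprVn; move: m0; rewrite /m; move: (16 ^+ N : R) => z z0.
    by field; exact: lt0r_neq0.
  apply: (@le_trans _ _ (\int[mu]_y (F y * cut_hilbert (gap n) (dipoles n) y)%:E)%E).
    have cn0 : 0 <= c * (n%:R * (2 / 3)) by rewrite ltW// !mulr_gt0 ?divr_gt0 ?ltr0n.
    apply: ge0_le_integral_any => y; first by rewrite -EFinM lee_fin mulr_ge0.
    rewrite -EFinM lee_fin /F !indicE.
    have [/set_mem [yN y01]|_] := boolP (y \in unit_cset N); last by rewrite !mulr0 mul0r.
    by rewrite !mulr1 ler_wpM2l ?(ltW c0)// integral_dipoles_ge.
  rewrite (cut_hilbert_swap g0 iF id).
  apply: le_trans (le_abse_integral mu measurableT (measurable_int _ iU)).
  by rewrite -abseN lee_abs.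
apply: (@hilbert_norm_ge _ p _ F) => //.
- by apply/measurable_EFinP; exact: measurable_int iF.
- apply: (@has_hilbert_grid _ _ N) => // x y xy; congr (_ * _); apply: indic_eq.
  by split; apply: unit_cset_floor.
- apply: (@le_trans _ _ (\int[mu]_x ((c `^ p * (v * m) `^ (- (p - 1)))%:E *
      (\1_(unit_cset N) x)%:E))%E).
    apply: ge0_le_integral_any => x; first by rewrite lee_fin mulr_ge0 ?powR_ge0.
    rewrite -EFinM lee_fin /F indicE.
    have [/set_mem [xN _]|_] := boolP (x \in unit_cset N); last first.
      by rewrite mulr0 normr0 powR0 ?gt_eqF// mul0r mulr0.
    rewrite !mulr1 (gtr0_norm c0) ler_wpM2l ?powR_ge0// /dual_cweight.
    by apply: ge0_ler_powRN; rewrite ?(ltW p10) ?mulr_gt0//; exact: cweight_on.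
  rewrite ge0_integralZl//; last 2 first.
  + by apply/measurable_EFinP; apply: measurable_indic; exact: measurable_unit_cset.
  + by rewrite lee_fin mulr_ge0 ?powR_ge0.
  rewrite integral_unit_cset -EFinM lee_fin exprVn -/m /c.
  rewrite powRM ?(ltW k0) ?(ltW m0)// kp powRM ?(ltW v0) ?(ltW m0)//.
  have vv : v `^ (p - 1) * v `^ (- (p - 1)) = 1.
    by rewrite powRN mulfV// gt_eqF// powR_gt0.
  have mm : m `^ p * m `^ (- (p - 1)) * m^-1 = 1.
    rewrite -powRD; last by apply/implyP => _; rewrite gt_eqF.
    by rewrite (_ : p + - (p - 1) = 1) ?powRr1 ?(ltW m0)// ?mulfV ?gt_eqF//; ring.
  rewrite le_eqVlt; apply/orP; left; apply/eqP.
  transitivity ((m `^ p * m `^ (- (p - 1)) * m^-1) * (v `^ (p - 1) * v `^ (- (p - 1)))).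
    by ring.
  by rewrite mm vv mulr1.
- by apply: integral_ge0 => x _; rewrite lee_fin mulr_ge0 ?powR_ge0.
apply: (@le_trans _ _ (\int[mu]_x (`|U x| `^ p * dual_cweight p N x)%:E)%E); last first.
  apply: ge0_le_integral_anyr => x; first by rewrite mulr_ge0 ?powR_ge0.
  by rewrite ler_wpM2r// ge0_ler_powR ?nnegrE ?(ltW p0).
(* Chosen so that t times the mass 2N is G / 2. *)
pose t := G / (4 * v); have t0 : 0 < t by rewrite divr_gt0// mulr_gt0.
pose a := t `^ (- (p - 1)) / p; have a0 : 0 < a by rewrite divr_gt0// powR_gt0.
have mUp : measurable_fun [set: R] (fun x => `|U x| `^ p * dual_cweight p N x).
  apply: measurable_funM.
    apply: (measurableT_comp (measurable_powR _)).
    by apply: measurableT_comp => //; exact: normr_measurable.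
  by apply: (measurableT_comp (measurable_powR _)); exact: measurable_cweight.
have mw : measurable_fun [set: R] (fun x => cweight N x * \1_`[0, 1[%classic x : R).
  by apply: measurable_funM; [exact: measurable_cweight|exact: measurable_indic].
have half : (G%:E <= a%:E * \int[mu]_x (`|U x| `^ p * dual_cweight p N x)%:E + (G / 2)%:E)%E.
  apply: le_trans GU _.
  have -> : (G / 2)%:E = (t%:E * \int[mu]_x (cweight N x * \1_`[0%R, 1%R[%classic x)%:E)%E.
    rewrite integral_cweight_unit -EFinM; congr EFin; rewrite /t -mulr_natl -/v.
    by field; exact: lt0r_neq0.
  have h0 x : (0 <= (`|U x| `^ p * dual_cweight p N x)%:E)%E.
    by rewrite lee_fin mulr_ge0 ?powR_ge0.
  have u0 x : (0 <= (cweight N x * \1_`[0%R, 1%R[%classic x)%:E)%E.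
    by rewrite lee_fin mulr_ge0// ltW.
  have mUpE : measurable_fun [set: R] (fun x => (`|U x| `^ p * dual_cweight p N x)%:E).
    exact/measurable_EFinP.
  have mwE : measurable_fun [set: R] (fun x => (cweight N x * \1_`[0%R, 1%R[%classic x)%:E).
    exact/measurable_EFinP.
  rewrite -ge0_integralZl ?lee_fin ?(ltW a0)//.
  rewrite -ge0_integralZl ?lee_fin ?(ltW t0)//.
  rewrite -ge0_integralD//; last 4 first.
  + by move=> x _; rewrite mule_ge0// lee_fin ltW.
  + exact: measurable_funeM.
  + by move=> x _; rewrite mule_ge0// lee_fin ltW.
  + exact: measurable_funeM.
  apply: ge0_le_integral_any => x //.
  rewrite abse_EFin -!EFinM -EFinD lee_fin indicE.
  have [_|x01] := boolP (x \in _).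
    by rewrite mulr1; exact: weighted_young.
  rewrite /U dipoles_out; last by move=> h; move: x01; rewrite mem_set.
  by rewrite mul0r normr0 !mulr0 addr0 mulr_ge0 ?(ltW a0)// mulr_ge0 ?powR_ge0.
have Hge0 : (0 <= \int[mu]_x (`|U x| `^ p * dual_cweight p N x)%:E)%E.
  by apply: integral_ge0 => x _; rewrite lee_fin mulr_ge0 ?powR_ge0.
apply: le_trans (ereal_half_le a0 Hge0 half); rewrite lee_fin.
have G4 : 0 < G / 4 by rewrite divr_gt0.
have vp : 0 < v `^ (p - 1) by rewrite powR_gt0.
have tE : a = p^-1 * ((G / 4) `^ (p - 1))^-1 * v `^ (p - 1).
  rewrite /a /t invfM mulrA mulrC powRM ?invr_ge0 ?(ltW v0) ?(ltW G4)//.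
  rewrite (_ : G * 4^-1 = G / 4)// powRN -mulrA; congr (_ * (_ * _)).
  by rewrite -powR_inv1 ?(ltW v0)// -powRrM mulrNN mul1r.
(* The constant 1/6 is a quarter of the 2/3 of the dipoles: a factor 1/2 is lost by absorption and
   another 1/2 by the choice of t. *)
have GE : n%:R * (1 / 6) = G / 4 / k.
  by rewrite /G; field; exact: lt0r_neq0.
have -> : (n%:R * (1 / 6)) `^ p = (G / 4) * (G / 4) `^ (p - 1) / v `^ (p - 1).
  rewrite GE powRM ?invr_ge0 ?(ltW k0) ?(ltW G4)//.
  rewrite -(powR_inv1 (ltW k0)) powRAC kp powR_inv1 ?powR_ge0//; congr (_ / _).
  rewrite -{2}(powRr1 (ltW G4)) -powRD; last by apply/implyP => _; rewrite gt_eqF.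
  by congr (_ `^ _); ring.
have gp : 0 < (G / 4) `^ (p - 1) by rewrite powR_gt0.
rewrite tE; move: ((G / 4) `^ (p - 1)) gp (v `^ (p - 1)) vp => X X0 Y Y0.
have -> : G / 2 / (p^-1 * X^-1 * Y) = (p * (G / 2)) * X / Y.
  by field; rewrite !gt_eqF.
rewrite ler_wpM2r ?invr_ge0 ?(ltW Y0)// ler_wpM2r ?(ltW X0)//.
have : G / 2 <= p * (G / 2) by rewrite ler_peMl ?(ltW p1)// divr_ge0// ltW.
lra.
Qed.

End dual_lower_bound.

(** * Choice of the weight for a given M *)

Section weights_exist.
Context {R : realType}.
Local Notation mu := (@lebesgue_measure R).
Implicit Types (w : R -> R) (p x : R) (N : nat).

Lemma bounded_weight w (B : R) : measurable_fun [set: R] w ->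
  (forall x, 0 < w x) -> (forall x, w x <= B) -> weight w.
Proof.
move=> mw w0 wB; split; last by apply: aeW.
split => //; first exact: openT.
move=> K _ cK; have mK := compact_measurable cK.
apply: (@le_lt_trans _ _ (\int[mu]_(x in K) (cst B%:E) x)%E).
  apply: ge0_le_integral => //.
  - apply/measurable_EFinP; apply: measurableT_comp; first exact: normr_measurable.
    exact: measurable_funTS.
  - by move=> x _; rewrite lee_fin gtr0_norm.
rewrite integral_cst// lte_mul_pinfty ?compact_finite_measure//.
by rewrite lee_fin (le_trans (ltW (w0 0))).
Qed.

Lemma weight_cweight N : (0 < N)%N -> weight (@cweight R N).
Proof.
move=> N0; apply: (@bounded_weight _ ((N%:R *+ 2) * 16 ^+ N)).
- exact: measurable_cweight.
- by move=> x; exact: cweight_gt0.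
- by move=> x; exact: cweight_le.
Qed.

Lemma weight_dual_cweight p N : 1 < p -> (0 < N)%N -> weight (@dual_cweight R p N).
Proof.
move=> p1 N0; apply: (@bounded_weight _ 1).
- by apply: (measurableT_comp (measurable_powR _)); exact: measurable_cweight.
- by move=> x; rewrite powR_gt0// cweight_gt0.
move=> x; have := @ge0_ler_powRN R (p - 1) 1 (cweight N x) _ ltr01 (cweight_ge1 x N0).
by rewrite powR1; apply; rewrite subr_ge0 ltW.
Qed.

(* Take [N] of order [M^(1/e)]. *)
Lemma extremal_weights p (e c C : R) (W : nat -> R -> R) : 0 < e -> 0 < c ->
  (forall N, (0 < N)%N -> weight (W N)) ->
  (forall N, (0 < N)%N -> ((c * N%:R `^ e)%:E <= fat_Ap p (W N))%E) ->
  (forall N, (0 < N)%N -> (fat_Ap p (W N) <= (C * N%:R `^ e)%:E)%E) ->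
  (forall n, (0 < n)%N -> ((n%:R * (1 / 6))%:E <= hilbert_norm p (W n.+1))%E) ->
  exists c' C' : R, 0 < c' /\ forall M : R, 2 < M -> exists w : R -> R,
    [/\ weight w, (M%:E <= fat_Ap p w)%E, (fat_Ap p w <= (C' * M)%:E)%E &
        ((c' * M `^ e^-1)%:E <= hilbert_norm p w)%E].
Proof.
move=> e0 c0 Ww Wc WC Wn.
(* Capping c at 1 gives M / k >= M > 1, so that X >= 1 and its integer part is positive. *)
pose k := Num.min c 1; have k0 : 0 < k by rewrite lt_min c0 ltr01.
have kc : k <= c by rewrite ge_min lexx.
have k1 : k <= 1 by rewrite ge_min lexx orbT.
(* The integer part of X is at least X / 2, which turns 1/6 into 1/12; [|C|] is used because no sign
   is known for [C]. *)
exists (1 / 12), (`|C| * 2 `^ e / k); split; first by rewrite divr_gt0.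
move=> M M2; have M0 : 0 < M by lra.
have MM : M <= M / k by rewrite ler_pdivlMr// ler_piMr// ltW.
have Mk0 : 0 < M / k by rewrite divr_gt0.
pose X : R := (M / k) `^ e^-1.
have ei : 0 <= e^-1 by rewrite invr_ge0 ltW.
have X1 : 1 <= X.
  have := @ge0_ler_powR R _ ei 1 (M / k); rewrite powR1 !nnegrE; apply => //.
    exact: ltW.
  by apply: le_trans MM; lra.
have Xe : X `^ e = M / k by rewrite /X -powRrM mulVf ?gt_eqF// powRr1// ltW.
(* For n the integer part of X, X < n + 1 <= 2 X: the first inequality gives the lower bound M of
   the characteristic, the second the factor 2^e in the upper bound. *)
have [/andP[nX Xn]] : (Num.truncn X)%:R <= X < (Num.truncn X).+1%:R.
  by apply: truncn_itv; apply: le_trans X1.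
have n0 : (0 < Num.truncn X)%N by rewrite truncn_gt0.
move: (Num.truncn X) nX Xn n0 => n nX Xn n0.
have n1 : 1 <= n%:R :> R by rewrite ler1n.
rewrite -natr1 in Xn.
have X0 : 0 <= X by exact: le_trans X1.
exists (W n.+1); split; first exact: Ww.
- apply: le_trans (Wc _ _) => //; rewrite lee_fin.
  have : M / k <= n.+1%:R `^ e.
    rewrite -Xe; apply: ge0_ler_powR; rewrite ?nnegrE ?(ltW e0)//.
    by rewrite -natr1 ltW.
  rewrite ler_pdivrMr// => /le_trans; apply; rewrite mulrC ler_wpM2r ?powR_ge0//.
- apply: le_trans (WC _ _) _ => //; rewrite lee_fin.
  apply: (@le_trans _ _ (`|C| * n.+1%:R `^ e)).
    by rewrite ler_wpM2r ?powR_ge0// ler_norm.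
  rewrite -!mulrA ler_wpM2l// [k^-1 * M]mulrC -Xe -powRM//.
  apply: ge0_ler_powR; rewrite ?nnegrE ?(ltW e0) ?mulr_ge0//.
  by rewrite -natr1; lra.
- apply: le_trans (Wn _ n0); rewrite lee_fin.
  have : M `^ e^-1 <= X by apply: ge0_ler_powR; rewrite ?nnegrE// ltW.
  lra.
Qed.

End weights_exist.

Theorem corollary1p2 (R : realType) (p : R) (hp : 1 < p) :
  exists c C : R, 0 < c /\
    forall M : R, 2 < M ->
      exists w : R -> R,
        [/\ weight w,
            (M%:E <= fat_Ap p w)%E,
            (fat_Ap p w <= (C * M)%:E)%E &
            ((c * M `^ Num.max 1 (p - 1)^-1)%:E <= hilbert_norm p w)%E].
Proof.
have p10 : 0 < p - 1 by rewrite subr_gt0.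
have [p2|p2] := leP 2 p.
  have -> : Num.max 1 (p - 1)^-1 = 1^-1.
    by rewrite invr1; apply/max_idPl; rewrite invf_le1//; lra.
  have [C WC] := fat_Ap_cweight_le hp; have [c c0 Wc] := fat_Ap_cweight_ge hp.
  apply: (@extremal_weights R p 1 c C (@cweight R)) => //.
  - exact: weight_cweight.
  - by move=> N N0; rewrite powRr1//; exact: Wc.
  - by move=> N N0; rewrite powRr1//; exact: WC.
  - move=> n _; apply: le_trans (hilbert_norm_cweight n hp).
    by rewrite lee_fin ler_wpM2l//; lra.
(* For p < 2 the dual family is used: its characteristic is of order N^(p-1) and the norm at least
   of order N, hence the exponent 1/(p - 1). *)
have -> : Num.max 1 (p - 1)^-1 = (p - 1)^-1.
  by apply/max_idPr; rewrite invf_ge1//; lra.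
have [C WC] := fat_Ap_dual_le hp; have [c c0 Wc] := fat_Ap_dual_ge hp.
apply: (@extremal_weights R p (p - 1) c C (dual_cweight p)) => //.
- by move=> N; exact: weight_dual_cweight.
- by move=> n n0; exact: hilbert_norm_dual.
Qed.
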